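(* Let $k,\Delta\in\mathbb{N}$ and $d,\alpha,C'>0$. Then there exist constants $C,C^*>0$ such that the following holds for all sufficiently large $n$. Let $G$ be an $n$-vertex $(d,\alpha)$-degenerate $k$-uniform hypergraph (with associated constant $\varepsilon$) with $\Delta(G)\le\Delta$, and let $H$ be an $n$-vertex $k$-uniform hypergraph. If there is a $(C'/n)$-vertex spread distribution $\mu$ on embeddings $\psi:G\to H$, then there exists a distribution $\mu'$ on the copies of $G$ in $H$ which is $(C/n^{1/d};r_0,\dots,r_l)$-spread and also $(C/n^{1/d},\,n^{-\alpha/(10d)};\,r_{l-1},1)$-spread (for some positive integer $l$), where $r_0=dn$, $r_1=\varepsilon n/k$, $r_i=r_{i-1}/n^{9\alpha/(10d)}$ for $2\le i\le l-1$, and $r_l=1$. Moreover, if $p\ge C^* n^{-1/d}$, then $\mathbb{P}[G\subseteq G^{(k)}(n,p)]=1-o_n(1)$, where $G\subseteq G^{(k)}(n,p)$ means $G^{(k)}(n,p)$ contains a copy of $G$.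
   Context: $m_1(G)=\max\{e(F)/(v(F)-1): F\subseteq G,\ v(F)>1\}$. An $n$-vertex $k$-uniform hypergraph $G$ on $V$ is $(d,\alpha)$-degenerate if $m_1(G)\le d$ and there is a constant $0<\varepsilon<1$ such that every $U\subseteq V$ with $2\le|U|\le\varepsilon n$ satisfies $e(G[U])\le d(|U|-1)-\alpha$. A hypergraph embedding $\psi:G\to H$ is an injective map $V(G)\to V(H)$ mapping edges of $G$ to edges of $H$. A probability distribution $\mu$ on injections $\psi:X\to Y$ is $q$-vertex spread if for every $s\le|X|$ and all distinct $x_1,\dots,x_s\in X$ and distinct $y_1,\dots,y_s\in Y$, $\mu(\{\psi(x_i)=y_i\ \forall i\in[s]\})\le q^s$. ''Copies of $G$ in $H$'' means the hypergraph $\mathcal{H}$ with vertex set $E(H)$ whose edges are the edge sets of subgraphs of $H$ isomorphic to $G$. For $q\in[0,1]$ and a decreasing sequence $r_0>\dots>r_l$, with $\mathcal{H}$ an $r_0$-bounded hypergraph on $V$, a probability measure $\mu$ on $E(\mathcal{H})$ is $(q;r_0,\dots,r_l)$-spread if for every $i\in[l]$, every $t\in[r_i,r_{i-1}]$ and every $S$ that is a $j$-subset of some edge $A\in E(\mathcal{H})$ with $j\in[r_i,r_{i-1}]$, $\mu(\{A\in E(\mathcal{H}):|A\cap S|\ge t\})\le q^t$. For $q,\gamma\in[0,1]$ and $r>r'$, $\mu$ is $(q,\gamma;r,r')$-spread if for all $t\in[r',r]$ and every $S$ that is a $j$-subset of some edge of $\mathcal{H}$ with $j\in[r',r]$, $\mu(\{A\in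 E(\mathcal{H}):|A\cap S|\ge t\})\le\gamma q^t$. $G^{(k)}(n,p)$ is the random $k$-uniform hypergraph on $n$ vertices where each $k$-set is an edge independently with probability $p$.
   Formalization: It is assumed that k ≥ 2 (for k = 1 the claim fails, e.g. G = H = all singletons with d = 2+α), and the spread distribution μ' is claimed only when G has at least one edge (for edgeless G one may have dn ≤ εn/k, so r_0,…,r_l need not decrease). *)

(* Defs.v *)
From mathcomp Require Import all_boot all_order all_algebra.
From mathcomp Require Import all_classical all_reals all_analysis.

Set Implicit Arguments.
Unset Strict Implicit.
Unset Printing Implicit Defensive.
Import Order.TTheory GRing.Theory Num.Theory.
Import numFieldNormedType.Exports.

Local Open Scope ring_scope.

(* A hypergraph on the finite vertex set [V] is its edge set; a hypergraph on
   a subset of [V] is a pair (vertex set, edge set). *)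
Notation hypergraph V := {set {set V}}.
Notation partial_hypergraph V := ({set V} * {set {set V}})%type.

Section Hypergraphs.
Context {V : finType}.

Definition k_uniform (k : nat) (G : hypergraph V) : bool :=
  [forall e in G, #|e| == k].

Definition max_degree (G : hypergraph V) : nat :=
  \max_(v : V) #|[set e in G | v \in e]|.

Definition induced_edges (G : hypergraph V) (U : {set V}) : hypergraph V :=
  [set e in G | e \subset U].

Definition subhypergraph (F : partial_hypergraph V) (G : hypergraph V) : bool :=
  (F.2 \subset G) && [forall e in F.2, e \subset F.1].

End Hypergraphs.

Section Isomorphism.
Context {V W : finType}.

Definition isomorphic (G : hypergraph V) (F : partial_hypergraph W) : bool :=
  [exists f : {ffun V -> W},
    [&& injectiveb f, f @: [set: V] == F.1 & [set f @: e | e : {set V} in G] == F.2]].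

Definition embeddings (G : hypergraph V) (H : hypergraph W) :
    {set {ffun V -> W}} :=
  [set f : {ffun V -> W} |
    injectiveb f && [forall e in G, f @: (e : {set V}) \in H]].

Definition copies (G : hypergraph V) (H : hypergraph W) :
    hypergraph {set W} :=
  [set A : {set {set W}} | [exists U : {set W},
    subhypergraph (U, A) H && isomorphic G (U, A)]].

End Isomorphism.

Section Degeneracy.
Context {R : realType} {V : finType}.

(* The default value 0 of the maximum is harmless: the ratios are nonnegative. *)
Definition m1 (G : hypergraph V) : R :=
  \big[Num.max/0]_(F : partial_hypergraph V
                     | subhypergraph F G && (1 < #|F.1|)%N)
    (#|F.2|%:R / (#|F.1|%:R - 1)).

Definition degenerate_with (d alpha eps : R) (G : hypergraph V) : Prop :=
  [/\ m1 G <= d, 0 < eps < 1 &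
      forall U : {set V}, (2 <= #|U|)%N -> #|U|%:R <= eps * #|V|%:R ->
        #|induced_edges G U|%:R <= d * (#|U|%:R - 1) - alpha].

End Degeneracy.

Section Distributions.
Context {R : realType}.

Definition distr_on {T : finType} (D : {set T}) (mu : T -> R) : Prop :=
  [/\ forall x, 0 <= mu x, forall x, x \notin D -> mu x = 0
    & \sum_(x : T) mu x = 1].

Definition pr {T : finType} (mu : T -> R) (E : {set T}) : R :=
  \sum_(x in E) mu x.

Definition vertex_spread {X Y : finType} (q : R)
    (mu : {ffun X -> Y} -> R) : Prop :=
  forall (s : nat) (x : 'I_s -> X) (y : 'I_s -> Y), (s <= #|X|)%N ->
    injective x -> injective y ->
    pr mu [set psi : {ffun X -> Y} | [forall i : 'I_s, psi (x i) == y i]]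
      <= q ^+ s.

(* The thresholds [r i] are real; restricting to integral [t] loses nothing,
   since the cardinals compared with them are integers and q <= 1. *)
Definition spread {T : finType} (HH : hypergraph T) (q : R) (l : nat)
    (r : nat -> R) (mu : {set T} -> R) : Prop :=
  [/\ 0 <= q <= 1,
      forall i, (1 <= i <= l)%N -> r i < r i.-1,
      forall A, A \in HH -> #|A|%:R <= r 0%N &
      forall (i t : nat) (A S : {set T}), (1 <= i <= l)%N ->
        r i <= t%:R <= r i.-1 ->
        A \in HH -> S \subset A -> r i <= #|S|%:R <= r i.-1 ->
        pr mu [set B in HH | (t <= #|B :&: S|)%N] <= q ^+ t].

Definition spread2 {T : finType} (HH : hypergraph T) (q gamma r r' : R)
    (mu : {set T} -> R) : Prop :=
  [/\ 0 <= q <= 1, 0 <= gamma <= 1, r' < r &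
      forall (t : nat) (A S : {set T}), r' <= t%:R <= r ->
        A \in HH -> S \subset A -> r' <= #|S|%:R <= r ->
        pr mu [set B in HH | (t <= #|B :&: S|)%N] <= gamma * q ^+ t].

(* Probability mass function of G^(k)(n,p): each k-set is an edge
   independently with probability p. *)
Definition random_hypergraph (k n : nat) (p : R) (E : hypergraph 'I_n) : R :=
  if k_uniform k E then
    \prod_(e : {set 'I_n} | #|e| == k) (if e \in E then p else 1 - p)
  else 0.

Definition pr_contains_copy {V : finType} (k n : nat) (p : R)
    (G : hypergraph V) : R :=
  pr (random_hypergraph k p) [set E : hypergraph 'I_n | copies G E != finset.set0].

End Distributions.

(* Main.v *)
(* A set [S] of edges of a copy of [G] is contained in a random copy of [G] with
   probability at most the number of homomorphisms from [S] to [G] times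
   [(C'/n)^v(S)].  Both factors are multiplicative over the connected components
   of [S]; bounded degree gives [n K^m] homomorphisms for a component with [m]
   edges, and degeneracy gives [m <= d (v - 1) - alpha] unless the component has
   more than [eps n] vertices, in which case the [2^-m] gained by enlarging the
   constant is smaller than [n^(-alpha/d)].  Hence, with [x = n^(1/d) / K0] and
   [u = n^(-alpha/d)], the sum of [P(T contained in the copy) x^|T|] over nonempty
   [T] inside [S] is at most [(1 + u)^|S| - 1], which gives all the spread bounds
   at once.

   For the threshold, expose the random hypergraph in a bounded number of rounds.
   After each round replace every surviving copy by a minimal remainder of some
   copy inside it.  A minimal remainder [X] after exposing [W] is determined inside
   one fixed copy chosen in the union of [W] and [X], so the bound above shows that
   all but an [n^(-alpha/(2d))]-fraction of the remainders shrink by a factor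
   [n^(alpha/(2d))] in each round; after boundedly many rounds they are empty. *)
Require Import Defs.
From mathcomp Require Import all_boot all_order all_algebra.
From mathcomp Require Import all_classical all_reals all_analysis.
(* Imported again so that [set0], [setU] and the like denote finite sets. *)
From mathcomp Require Import fintype finset.
From mathcomp Require Import ring zify.
Import Order.TTheory GRing.Theory Num.Theory.
Import numFieldNormedType.Exports.

Set Implicit Arguments.
Unset Strict Implicit.
Unset Printing Implicit Defensive.

Local Open Scope ring_scope.

(** * Connected sets and the exploration bound on their generating function *)

Section Reach.
Context {R : realType} {E : finType} (adj : rel E).
Implicit Types (Q C S T X : {set E}).

(* Every element of [C] is joined to [Q] inside [C], phrased by cuts so that no
   paths are needed. *)
Definition reach Q C : bool :=
  [forall X : {set E}, (X \subset C) && (X != set0) && [disjoint X & Q] ==>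
     [exists x in X, [exists y in C :\: X, adj y x]]].

Lemma reachP Q C :
  reflect (forall X, X \subset C -> X != set0 -> [disjoint X & Q] ->
             exists x y, [/\ x \in X, y \in C, y \notin X & adj y x])
          (reach Q C).
Proof.
apply: (iffP forallP) => [h X XC X0 XQ | h X].
  have := h X; rewrite XC X0 XQ /= => /existsP[x /andP[xX /existsP[y /andP[]]]].
  by rewrite inE => /andP[yX yC] a; exists x, y.
apply/implyP => /andP[/andP[XC X0] XQ].
have [x [y [xX yC yX a]]] := h X XC X0 XQ.
by apply/existsP; exists x; rewrite xX; apply/existsP; exists y; rewrite inE yX yC.
Qed.

Lemma reach_disjoint Q C : reach Q C -> [disjoint C & Q] -> C = set0.
Proof.
move=> /reachP h CQ; apply/eqP; case: (eqVneq C set0) => // C0.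
by have [x [y [_ -> //]]] := h C (subxx _) C0 CQ.
Qed.

(** The branch of the exploration where [q] is absent: a cut inside [C] never contains [q], so
    queueing [q] makes no difference. *)
Lemma reach_rem Q C q : reach Q C -> q \notin C -> reach (Q :\ q) C.
Proof.
move=> /reachP h qC; apply/reachP => X XC X0 XQ; apply: h => //.
apply/pred0P => x /=; apply/negbTE/negP => /andP[xX xQ].
move/pred0P: XQ => /(_ x) /=; rewrite !inE xX xQ andbT /= => /negbFE/eqP xq.
by rewrite -xq (subsetP XC) in qC.
Qed.

(** The branch where [q] is present: a cut avoiding the neighbours of [q] is crossed by a pair that
    does not start at [q]. *)
Lemma reach_visit Q C q : reach Q (q |: C) -> q \notin C ->
  reach ((Q :\ q) :|: [set x | adj q x]) C.
Proof.
move=> /reachP h qC; apply/reachP => X XC X0 XQ.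
have XQ' z : z \in X -> (z \notin Q) && ~~ adj q z.
  move=> zX; move/pred0P: XQ => /(_ z) /=; rewrite !inE zX /= => /negbT.
  rewrite !negb_or negb_and negbK => /andP[/orP[/eqP zq|-> ->//]].
  by rewrite -zq (subsetP XC) in qC.
have [||x [y [xX yC yX a]]] := h X _ X0.
- exact: subset_trans XC (subsetUr _ _).
- by apply/pred0P => z /=; apply/negbTE/negP => /andP[/XQ' /andP[/negP]].
exists x, y; split=> //; move: yC; rewrite !inE => /orP[/eqP yq|//].
by move: (XQ' x xX); rewrite -yq a andbF.
Qed.

Lemma sum_subset_split (F : {set E} -> R) (P : pred {set E}) S q : q \in S ->
  \sum_(C : {set E} | (C \subset S) && P C) F C =
  \sum_(C : {set E} | (C \subset S :\ q) && P C) F C +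
  \sum_(C : {set E} | (C \subset S :\ q) && P (q |: C)) F (q |: C).
Proof.
move=> qS; rewrite (bigID (fun C : {set E} => q \in C)) /= addrC; congr (_ + _).
  by apply: eq_bigl => C; rewrite subsetD1 -andbA [P C && _]andbC andbA.
rewrite (reindex_onto (fun C => q |: C) (fun C => C :\ q)) /=; last first.
  by move=> C /andP[_ qC]; rewrite setD1K.
apply: eq_bigl => C; rewrite subUset sub1set qS setU11 andbT /= subsetD1.
case: (boolP (q \in C)) => qC /=.
  rewrite andbF; apply/negbTE/negP => /andP[_ /eqP] h.
  by move: qC; rewrite -h !inE eqxx.
by rewrite setU1K // eqxx !andbT.
Qed.

(* Exploration: reveal whether [q] belongs to [C], then replace [q] in the queue
   by its neighbours. *)
Lemma sum_reach_le (D : nat) (y : R) S Q :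
  (forall q, #|[set x | adj q x]| <= D)%N -> 0 <= y -> y * 2 ^+ D <= 1 ->
  \sum_(C : {set E} | (C \subset S) && reach Q C) y ^+ #|C| <= 2 ^+ #|Q|.
Proof.
move=> degD y0 yD; have [m] := ubnP #|S|; elim: m => // m IH in S Q *.
rewrite ltnS => Sm.
(* With no queued element left in [S], only the empty set can be reached. *)
have [SQ|] := boolP [disjoint S & Q].
  rewrite (eq_bigl (fun C => (C == set0) && reach Q C)); last first.
    move=> C; case: (eqVneq C set0) => [->|C0]; first by rewrite sub0set.
    apply/negbTE/negP => /andP[CS rC]; move/eqP: C0; apply.
    by apply: reach_disjoint rC _; apply: disjointWl CS SQ.
  apply: (@le_trans _ _ (\sum_(C : {set E} | C == set0) y ^+ #|C|)).
    rewrite (bigID (fun C => reach Q C) (fun C : {set E} => C == set0)) /=.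
    by rewrite lerDl sumr_ge0 // => C _; exact: exprn_ge0.
  by rewrite big_pred1_eq cards0 expr0 exprn_ege1 // ler1n.
rewrite -setI_eq0 => /set0Pn[q]; rewrite inE => /andP[qS qQ].
have Sm' : (#|S :\ q| < m)%N by rewrite (leq_trans _ Sm) // (cardsD1 q S) qS.
rewrite (sum_subset_split _ (reach Q) qS) (cardsD1 q Q) qQ add1n exprS.
(* [2 ^+ #|Q|] is twice [2 ^+ #|Q :\ q|], and one half pays for each answer about [q]. *)
rewrite mulr_natl mulr2n lerD //.
  rewrite (le_trans _ (IH (S :\ q) (Q :\ q) Sm')) //.
  rewrite [leRHS](bigID (reach Q)) /=.
  rewrite (eq_bigl (fun C : {set E} =>
    (C \subset S :\ q) && reach (Q :\ q) C && reach Q C)).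
    by rewrite lerDl sumr_ge0 // => C _; exact: exprn_ge0.
  move=> C; case: (boolP (C \subset S :\ q)) => //= CS.
  case: (boolP (reach Q C)) => rC; last by rewrite andbF.
  by rewrite andbT reach_rem //; move: CS; rewrite subsetD1 => /andP[].
set Q' := (Q :\ q) :|: [set x | adj q x].
apply: (@le_trans _ _
  (y * \sum_(C : {set E} | (C \subset S :\ q) && reach Q' C) y ^+ #|C|)).
  rewrite big_distrr /= [leRHS](bigID (fun C => reach Q (q |: C))) /=.
  rewrite ler_wpDr ?sumr_ge0 //; first by move=> C _; rewrite mulr_ge0 ?exprn_ge0.
  rewrite le_eqVlt; apply/orP; left; apply/eqP; apply: eq_big => [C|C].
    case: (boolP (C \subset S :\ q)) => //= CS.
    case: (boolP (reach Q (q |: C))) => rC; last by rewrite andbF.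
    by rewrite andbT reach_visit //; move: CS; rewrite subsetD1 => /andP[].
  by rewrite subsetD1 => /andP[/andP[_ qC] _]; rewrite cardsU1 qC exprS.
apply: (le_trans (ler_wpM2l y0 (IH (S :\ q) Q' Sm'))).
(* The queue gains at most [D] elements; the factor [y] earned by [q] pays for [2 ^+ D]. *)
apply: (@le_trans _ _ (y * (2 ^+ (#|Q :\ q| + D)))).
  rewrite ler_wpM2l // ler_weXn2l // ?ler1n //.
  by rewrite (leq_trans (leq_card_setU _ _)) // leq_add2l.
by rewrite exprD mulrCA ler_piMr // exprn_ge0.
Qed.

End Reach.

(** * Decomposition into connected components *)

Section Components.
Context {R : realType} {E : finType} (adj : rel E).
Implicit Types (C S T U : {set E}).

(** A set of largest cardinality stands in for the usual union of paths. The default [[set e]] is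
    admissible as soon as [e \in T]. *)
Definition component (e : E) T : {set E} :=
  [arg max_(C > [set e] | [&& e \in C, C \subset T & reach adj [set e] C]) #|C|].

(** For the last clause, an outside element of [T] adjacent to the component could be added to it,
    against maximality. *)
Lemma componentP e T : symmetric adj -> e \in T ->
  [/\ e \in component e T, component e T \subset T,
      reach adj [set e] (component e T) &
      forall x y, x \in component e T -> y \in T -> y \notin component e T -> ~~ adj x y].
Proof.
move=> adjC eT; rewrite /component; case: arg_maxnP => [|C /and3P[eC CT /reachP rC] maxC].
  rewrite set11 sub1set eT /=; apply/reachP => X; rewrite subset1.
  by case/orP=> /eqP-> => [_|]; rewrite ?eqxx // disjoints1 set11.
split=> //; first exact/reachP.
move=> x y xC yT yC; apply/negP => xy.
suff /maxC : [&& e \in y |: C, y |: C \subset T & reach adj [set e] (y |: C)].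
  by rewrite cardsU1 yC add1n /= ltnn.
rewrite subUset sub1set yT CT inE eC orbT /=; apply/reachP => X XC X0 Xe.
have [yX|yX] := boolP (y \in X); last first.
  have [|u [v [uX vC vX a]]] := rC X _ X0 Xe; last first.
    by exists u, v; split=> //; rewrite inE vC orbT.
  apply/subsetP => z zX; move/subsetP: XC => /(_ z zX); rewrite !inE.
  by case/orP=> // /eqP zy; rewrite -zy zX in yX.
(* A cut containing [y] is [y] alone, crossed from [x], or leaves a nonempty cut [X :\ y] of [C].
   The crossing vertex of the latter lies in [C], so it is not [y]. *)
have [Xy|Xy] := eqVneq (X :\ y) set0.
  exists y, x; split=> //; first by rewrite inE xC orbT.
  apply/negP => xX; have : x \in X :\ y by rewrite !inE xX (memPn yC).
  by rewrite Xy inE.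
have [||u [v [uX vC vX a]]] := rC (X :\ y) _ Xy _.
- apply/subsetP => z; rewrite !inE => /andP[zy zX].
  by move/subsetP: XC => /(_ z zX); rewrite !inE (negbTE zy).
- by apply: disjointWl Xe; exact: subD1set.
exists u, v; split=> //; first by case/setD1P: uX.
  by rewrite inE vC orbT.
by apply: contra vX => vX; rewrite !inE vX andbT; apply: contraNneq yC => <-.
Qed.

(* Peeling off the component of one element of [S] at a time bounds the
   generating function of a weight that is submultiplicative over components. *)
Lemma sum_components_le U S (a b : {set E} -> R) (A : R) :
  symmetric adj -> 0 <= A -> (forall T, 0 <= a T) -> (forall C, 0 <= b C) ->
  a set0 <= 1 ->
  (forall e C T, e \in C -> reach adj [set e] C -> C :|: T \subset U ->
    [disjoint C & T] -> (forall x y, x \in C -> y \in T -> ~~ adj x y) ->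
    a (C :|: T) <= b C * a T) ->
  (forall e, e \in U ->
    \sum_(C : {set E} | [&& C \subset U, e \in C & reach adj [set e] C]) b C <= A) ->
  S \subset U ->
  \sum_(T : {set E} | T \subset S) a T <= (1 + A) ^+ #|S|.
Proof.
move=> adjC A0 a0 b0 aset0 aM bA.
have [m] := ubnP #|S|; elim: m => // m IH in S *.
rewrite ltnS => Sm SU.
have [->|/set0Pn[e eS]] := eqVneq S set0.
  rewrite cards0 expr0 (eq_bigl (fun T => T == set0)) ?big_pred1_eq //.
  by move=> T; rewrite subset0.
have eU := subsetP SU e eS.
have Sm' : (#|S :\ e| < m)%N by rewrite (leq_trans _ Sm) // (cardsD1 e S) eS.
have SeU : S :\ e \subset U by apply: subset_trans SU; exact: subD1set.
have IHe := IH _ Sm' SeU.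
rewrite (bigID (fun T : {set E} => e \in T)) /= addrC (cardsD1 e S) eS add1n exprS.
(* The summand 1 of [1 + A] accounts for the sets without [e], the summand [A] for those with [e],
   grouped by the component of [e]. *)
rewrite mulrDl mul1r lerD //.
  rewrite (eq_bigl (fun T : {set E} => T \subset S :\ e)) //.
  by move=> T; rewrite subsetD1.
pose P C := [&& C \subset U, e \in C & reach adj [set e] C].
rewrite (partition_big (component e) P) /=; last first.
  move=> T /andP[TS eT]; have [h1 h2 h3 _] := componentP adjC eT.
  by rewrite /P h1 h3 (subset_trans h2) // (subset_trans TS).
apply: (@le_trans _ _ (\sum_(C | P C) b C * (1 + A) ^+ #|S :\ e|)); last first.
  rewrite -mulr_suml ler_wpM2r ?bA // exprn_ge0 // addr_ge0 //.
apply: ler_sum => C /and3P[CU eC rC].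
(* Removing the fixed component [C] is injective into the subsets of [S :\ e]; summing over all of
   these only adds nonnegative terms. *)
apply: (@le_trans _ _ (b C * \sum_(T : {set E} | T \subset S :\ e) a T)); last first.
  by rewrite ler_wpM2l.
rewrite (reindex_onto (fun T => C :|: T) (fun T => T :\: C)) /=; last first.
  move=> T /andP[/andP[_ eT] /eqP <-].
  have [_ /subsetP CT _ _] := componentP adjC eT.
  by apply/setP => z; rewrite !inE; case: (boolP (z \in component e T)) => //= /CT ->.
rewrite big_distrr /= [leRHS](bigID (fun T => [disjoint C & T])) /=.
rewrite ler_wpDr ?sumr_ge0 //; first by move=> T _; rewrite mulr_ge0.
rewrite big_mkcond [leRHS]big_mkcond /=; apply: ler_sum => T _.
case: ifP => [/andP[/andP[/andP[CTS eCT] /eqP CT] /eqP dT]|_]; last first.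
  by case: ifP => // _; rewrite mulr_ge0.
have dCT : [disjoint C & T].
  rewrite -setI_eq0 -dT; apply/eqP/setP => z; rewrite !inE.
  by case: (z \in C); rewrite ?andbF.
have -> : T \subset S :\ e.
  rewrite subsetD1 (subset_trans (subsetUr C T)) //=.
  by move/disjointFr: dCT => /(_ e eC) ->.
rewrite dCT /=; apply: (aM e) => //; first by rewrite (subset_trans CTS).
move=> x y xC yT; have [_ _ _] := componentP adjC eCT; rewrite CT; apply => //.
  by rewrite inE yT orbT.
by move/disjointFl: dCT => ->.
Qed.

End Components.

(** * Counting homomorphisms between edge sets *)

Lemma leq_card_bigcup (I T : finType) (P : pred I) (F : I -> {set T}) :
  (#|\bigcup_(i | P i) F i| <= \sum_(i | P i) #|F i|)%N.
Proof.
elim/big_ind2: _ => [|m A n B hA hB|//]; first by rewrite cards0.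
by rewrite (leq_trans (leq_card_setU _ _)) // leq_add.
Qed.

Lemma leq_card_fibres (T I : finType) (h : T -> I) (A : {set T}) (B : {set I}) m :
  (forall x, x \in A -> h x \in B) ->
  (forall i, i \in B -> (#|[set x in A | h x == i]| <= m)%N) ->
  (#|A| <= #|B| * m)%N.
Proof.
move=> hB hm; rewrite -sum1_card (partition_big h (mem B)) //=.
rewrite -sum_nat_const leq_sum // => i /hm; apply: leq_trans.
by rewrite -sum1_card; apply/eq_leq/eq_bigl => x; rewrite inE.
Qed.

Section Homomorphisms.
Context {V : finType}.
Implicit Types (G T A B C : {set {set V}}) (e f : {set V}) (phi : {ffun V -> V}).

(* Maps are normalised to be the identity outside the vertices of [T], so that
   counting them counts the homomorphisms from [T] to [G]. *)
Definition homs G T : {set {ffun V -> V}} :=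
  [set phi : {ffun V -> V} | [forall v, (v \notin cover T) ==> (phi v == v)] &&
             [forall e in T, phi @: (e : {set V}) \in G]].

Definition restrict T phi : {ffun V -> V} :=
  [ffun v => if v \in cover T then phi v else v].

Lemma homsP G T phi :
  reflect ((forall v, v \notin cover T -> phi v = v) /\
           (forall e, e \in T -> phi @: e \in G)) (phi \in homs G T).
Proof.
rewrite inE; apply: (iffP andP) => -[h1 h2]; split.
- by move=> v vT; move/forallP: h1 => /(_ v); rewrite vT => /eqP.
- by move=> e eT; move/forallP: h2 => /(_ e); rewrite eT.
- by apply/forallP => v; apply/implyP => /h1 ->.
- by apply/forallP => e; apply/implyP => /h2.
Qed.

Lemma mem_cover T e v : e \in T -> v \in e -> v \in cover T.
Proof. by move=> eT ve; apply/bigcupP; exists e. Qed.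

Lemma restrict_imset T phi e : e \in T -> restrict T phi @: e = phi @: e.
Proof.
by move=> eT; apply: eq_in_imset => v ve; rewrite ffunE (mem_cover eT).
Qed.

Lemma restrict_homs G A T phi : A \subset T -> phi \in homs G T ->
  restrict A phi \in homs G A.
Proof.
move=> /subsetP AT /homsP[h1 h2]; apply/homsP; split=> [v vA|e eA].
  by rewrite ffunE (negbTE vA).
by rewrite restrict_imset // h2 // AT.
Qed.

Lemma coverU A B : cover (A :|: B) = cover A :|: cover B :> {set V}.
Proof. by rewrite /cover bigcup_setU. Qed.

Lemma card_homs0 G : (#|homs G set0| <= 1)%N.
Proof.
rewrite -(cards1 (finfun id : {ffun V -> V})) subset_leq_card //.
apply/subsetP => phi /homsP[h _]; rewrite inE; apply/eqP/ffunP => v.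
by rewrite ffunE h // /cover big_set0 inE.
Qed.

(** A normalised map is determined by its restrictions to [A] and to [B]. *)
Lemma card_homsU G A B :
  (#|homs G (A :|: B)| <= #|homs G A| * #|homs G B|)%N.
Proof.
rewrite -cardsX -(@card_in_imset _ _ (fun phi => (restrict A phi, restrict B phi))).
  apply/subset_leq_card/subsetP => _ /imsetP[phi h ->].
  by rewrite inE /= !(restrict_homs _ h) ?subsetUl ?subsetUr.
move=> phi phi' /homsP[h _] /homsP[h' _] [/ffunP hA /ffunP hB]; apply/ffunP => v.
have := hA v; have := hB v; rewrite !ffunE.
case: ifP => // vB _; case: ifP => // vA _.
by rewrite h ?h' // coverU inE vA vB.
Qed.

(* Once a map is fixed off [e] and the image [f] of [e] is chosen, at most
   [k ^ k] choices remain. *)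
Lemma card_homsU1 G T e k m : k_uniform k G -> #|e| = k ->
  (forall phi, phi \in homs G T ->
     (#|[set f in G | [forall v in e :&: cover T, phi v \in f]]| <= m)%N) ->
  (#|homs G (e |: T)| <= #|homs G T| * (m * k ^ k))%N.
Proof.
move=> /forallP kG ek hm.
apply: (leq_card_fibres (h := restrict T)) => [phi|phi phiT].
  by apply: restrict_homs; exact: subsetUr.
pose F := [set f : {set V} in G | [forall v in e :&: cover T, phi v \in f]].
(* All of [e] is left free inside [f], even the vertices already mapped; this overcounts but gives
   the uniform number [k ^ k]. *)
pose fill (f : {set V}) : {set {ffun V -> V}} :=
  [set psi : {ffun V -> V} in
     family (fun v => if v \in e then pred_of_set f else pred1 (phi v))].
apply: (@leq_trans #|\bigcup_(f in F) fill f|).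
  apply/subset_leq_card/subsetP => psi; rewrite inE => /andP[/homsP[h1 h2] /eqP rpsi].
  apply/bigcupP; exists (psi @: e); last first.
    rewrite inE; apply/familyP => v; case: (boolP (v \in e)) => ve.
      by apply: imset_f.
    rewrite -rpsi inE ffunE; case: ifP => // vT.
    by rewrite h1 // coverU inE negb_or vT /cover big_set1 ve.
  rewrite inE h2 ?setU11 //=; apply/forallP => v; apply/implyP; rewrite inE.
  by case/andP=> ve vT; rewrite -rpsi ffunE vT imset_f.
apply: (leq_trans (leq_card_bigcup _ _)).
apply: (@leq_trans (\sum_(f in F) k ^ k)%N); last first.
  by rewrite sum_nat_const leq_mul2r hm ?orbT.
apply: leq_sum => f; rewrite inE => /andP[fG _].
have fk : #|f| = k by apply/eqP; move: (kG f); rewrite fG.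
rewrite cardsE card_family foldrE big_map big_enum /=.
rewrite (bigID (mem e)) /= [X in (_ * X)%N]big1 ?muln1; last first.
  by move=> v /negbTE ->; rewrite card1.
rewrite (eq_bigr (fun=> k)); last by move=> v ->; rewrite -fk.
by rewrite prod_nat_const ek.
Qed.

Lemma card_uniform_le G k : (0 < k)%N -> k_uniform k G ->
  (#|G| <= #|V| * max_degree G)%N.
Proof.
move=> k0 /forallP kG.
have -> : G = \bigcup_(v : V) [set e in G | v \in e].
  apply/setP => e; apply/idP/bigcupP => [eG|[v _]]; last by rewrite inE => /andP[].
  have : e != set0.
    by rewrite -card_gt0; move: (kG e); rewrite eG /= => /eqP ->.
  by case/set0Pn=> v ve; exists v; rewrite // inE eG.
apply: (leq_trans (leq_card_bigcup _ _)).
rewrite -sum_nat_const leq_sum // => v _.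
set G' := (X in max_degree X).
have -> : G' = G.
  apply/setP => e; apply/bigcupP/idP => [[w _]|eG]; first by rewrite inE => /andP[].
  have : e != set0.
    by rewrite -card_gt0; move: (kG e); rewrite eG /= => /eqP ->.
  by case/set0Pn=> w we; exists w; rewrite // inE eG.
by rewrite /max_degree (leq_bigmax (F := fun v => #|[set e in G | v \in e]|)).
Qed.

(** Requiring both edges to lie in [G] bounds the degree of the relation at every set, as the
    exploration bound demands. *)
Definition meet_in G : rel {set V} :=
  fun e f => [&& e \in G, f \in G & ~~ [disjoint e & f]].

Lemma meet_in_sym G : symmetric (meet_in G).
Proof. by move=> e f; rewrite /meet_in andbCA disjoint_sym. Qed.

Lemma card_meet_in G k e : k_uniform k G ->
  (#|[set f | meet_in G e f]| <= k * max_degree G)%N.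
Proof.
move=> /forallP kG; case: (boolP (e \in G)) => eG; last first.
  rewrite (_ : [set f | _] = set0) ?cards0 //.
  by apply/setP => f; rewrite !inE /meet_in (negbTE eG).
have ek : #|e| = k by apply/eqP; move: (kG e); rewrite eG.
apply: (@leq_trans #|\bigcup_(v in e) [set f in G | v \in f]|).
  apply/subset_leq_card/subsetP => f; rewrite inE => /and3P[_ fG].
  rewrite -setI_eq0 => /set0Pn[v]; rewrite inE => /andP[ve vf].
  by apply/bigcupP; exists v => //; rewrite inE fG.
apply: (leq_trans (leq_card_bigcup _ _)).
rewrite -ek -sum_nat_const leq_sum // => v _.
by rewrite /max_degree (leq_bigmax (F := fun v => #|[set e in G | v \in e]|)).
Qed.

(* A connected [C] is grown one edge at a time: the first edge has at most
   [|G| k^k] images, every other one shares a mapped vertex with its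
   predecessors and has at most [Delta k^k] images. *)
Lemma card_homs_connected G C e k : (0 < k)%N -> k_uniform k G -> C \subset G ->
  e \in C -> reach (meet_in G) [set e] C ->
  (#|homs G C| <= #|V| * (max_degree G * k ^ k) ^ #|C|)%N.
Proof.
move=> k0 kG CG eC /reachP rC.
have kE f : f \in C -> #|f| = k.
  by move=> /(subsetP CG) fG; apply/eqP; move/forallP: kG => /(_ f); rewrite fG.
have base : (#|homs G [set e]| <= #|V| * (max_degree G * k ^ k))%N.
  have := @card_homsU1 G set0 e k #|G| kG (kE e eC); rewrite setU0 => h.
  apply: (leq_trans (h _)).
    by move=> phi _; apply/subset_leq_card/subsetP => f; rewrite inE => /andP[].
  rewrite (leq_trans (leq_mul (card_homs0 G) (leqnn _))) // mul1n mulnA leq_mul2r.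
  by rewrite (card_uniform_le k0 kG) orbT.
(* Intermediate sets of every size from 1 to [#|C|]; the last one is [C]. *)
suff grow m : (m < #|C|)%N -> exists Y : {set {set V}},
    [/\ Y \subset C, e \in Y, #|Y| = m.+1 &
    (#|homs G Y| <= #|V| * (max_degree G * k ^ k) ^ m.+1)%N].
  have C0 : (0 < #|C|)%N by apply/card_gt0P; exists e.
  have [|Y [YC _ Ym hY]] := grow #|C|.-1; first by rewrite prednK.
  rewrite prednK // in Ym hY; suff <- : Y = C by rewrite Ym.
  by apply/eqP; rewrite eqEcard YC Ym /=.
elim: m => [_|m IH mC].
  by exists [set e]; rewrite sub1set eC set11 cards1 expn1; split.
have [|Y [YC eY Ym hY]] := IH; first exact: ltnW.
(* The cut [C :\: Y] provides an edge [x] outside [Y] that meets an edge [y] of [Y]. *)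
have [|||x [y [xX yC yX a]]] := rC (C :\: Y).
- exact: subsetDl.
- by rewrite -card_gt0 cardsD (setIidPr YC) Ym subn_gt0.
- by rewrite disjoint_sym disjoints1 inE eY.
have yY : y \in Y by move: yX; rewrite inE yC andbT negbK.
have [xC xY] : x \in C /\ x \notin Y by move: xX; rewrite inE => /andP[].
exists (x |: Y); rewrite subUset sub1set xC YC inE eY orbT cardsU1 xY Ym; split=> //.
apply: (leq_trans (@card_homsU1 G Y x k (max_degree G) kG (kE x xC) _)).
  move=> phi _; case/and3P: a => yG xG; rewrite -setI_eq0 => /set0Pn[v].
  rewrite inE => /andP[vy vx].
  (* The shared vertex [v] is already mapped, so the image of [x] is an edge through [phi v]. *)
  apply: (@leq_trans #|[set f in G | phi v \in f]|).
    apply/subset_leq_card/subsetP => f; rewrite !inE => /andP[-> /forallP /(_ v)].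
    by rewrite inE vx (mem_cover yY vy).
  by rewrite /max_degree (leq_bigmax (F := fun v => #|[set e in G | v \in e]|)).
by rewrite (expnSr _ m.+1) [leqRHS]mulnA leq_mul2r hY orbT.
Qed.

End Homomorphisms.

(** * Images of edge sets, and edge counts from degeneracy *)

Section EdgeImages.
Context {V W : finType}.
Implicit Types (psi : {ffun V -> W}) (G T : {set {set V}}).

Definition edge_image psi G : {set {set W}} := [set psi @: (e : {set V}) | e in G].

Lemma mem_edge_image psi G e : e \in G -> psi @: e \in edge_image psi G.
Proof. by move=> eG; apply/imsetP; exists e. Qed.

Lemma card_edge_image psi G : injective psi -> #|edge_image psi G| = #|G|.
Proof. by move=> inj; rewrite card_imset //; exact: imset_inj. Qed.

Lemma sub_edge_image psi G (S : {set {set W}}) : S \subset edge_image psi G ->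
  exists2 T : {set {set V}}, T \subset G & S = edge_image psi T.
Proof.
move=> SG; exists [set e in G | psi @: e \in S].
  by apply/subsetP => e; rewrite inE => /andP[].
apply/setP => f; apply/idP/imsetP => [fS|[e]].
  have /imsetP[e eG fe] := subsetP SG f fS.
  by exists e; rewrite // inE eG -fe.
by rewrite inE => /andP[_ eS] ->.
Qed.

End EdgeImages.

Section Degenerate.
Context {R : realType} {V : finType} (d alpha eps : R) (k : nat).
Context (G : {set {set V}}).
Context (k2 : (2 <= k)%N) (kG : k_uniform k G)
  (degG : degenerate_with d alpha eps G).

Lemma uniform_card e : e \in G -> #|e| = k.
Proof. by move=> eG; apply/eqP; move/forallP: kG => /(_ e); rewrite eG. Qed.

Lemma card_cover_le (C : {set {set V}}) : C \subset G -> (#|cover C| <= k * #|C|)%N.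
Proof.
move=> /subsetP CG; rewrite (leq_trans (leq_card_bigcup _ _)) //.
by rewrite mulnC -sum_nat_const leq_sum // => e /CG /uniform_card ->.
Qed.

Lemma card_cover_ge (C : {set {set V}}) : C \subset G -> C != set0 -> (k <= #|cover C|)%N.
Proof.
move=> /subsetP CG /set0Pn[e eC]; rewrite -(uniform_card (CG e eC)).
by apply/subset_leq_card/subsetP => v; exact: mem_cover.
Qed.

(** The pair [(cover C, C)] competes in the maximum [m1], since [2 <= k] gives it more than one
    vertex. *)
Lemma card_edges_le (C : {set {set V}}) : C \subset G -> C != set0 ->
  #|C|%:R <= d * (#|cover C|%:R - 1).
Proof.
move=> CG C0; have v1 := leq_trans k2 (card_cover_ge CG C0).
have [m1d _ _] := degG; rewrite -ler_pdivrMr ?subr_gt0 ?ltr1n //.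
apply: le_trans m1d; rewrite /m1.
apply: (@le_bigmax_cond _ _ _ _ (cover C, C) _
  (fun F : {set V} * {set {set V}} => #|F.2|%:R / (#|F.1|%:R - 1))) => /=.
rewrite /subhypergraph /= CG v1 andbT; apply/forallP => e; apply/implyP => eC.
by apply/subsetP => v; exact: mem_cover.
Qed.

Lemma card_edges_le_small (C : {set {set V}}) : C \subset G -> C != set0 ->
  #|cover C|%:R <= eps * #|V|%:R -> #|C|%:R <= d * (#|cover C|%:R - 1) - alpha.
Proof.
move=> CG C0 small; have v1 := leq_trans k2 (card_cover_ge CG C0).
have [_ _ /(_ _ v1 small)] := degG; apply: le_trans.
rewrite ler_nat; apply/subset_leq_card/subsetP => e eC.
by rewrite inE (subsetP CG) //; apply/subsetP => v; exact: mem_cover.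
Qed.

Lemma edges_le_linear : 0 < d -> G != set0 -> #|G|%:R <= d * #|V|%:R.
Proof.
move=> d0 G0; apply: (le_trans (card_edges_le (subxx _) G0)).
rewrite ler_pM2l // lerBlDr (le_trans (_ : _ <= #|V|%:R)) ?ler_nat ?max_card //.
by rewrite lerDl.
Qed.

End Degenerate.

(** * From vertex spread to containment probabilities *)

Section VertexSpread.
Context {R : realType} {V W : finType} (mu : {ffun V -> W} -> R).
Context (G : {set {set V}}).

Lemma pr_le (T : finType) (nu : T -> R) (A B : {set T}) :
  (forall x, 0 <= nu x) -> (forall x, nu x != 0 -> x \in A -> x \in B) ->
  pr nu A <= pr nu B.
Proof.
move=> nu0 AB; rewrite /pr big_mkcond [leRHS]big_mkcond; apply: ler_sum => x _.
case: ifPn => xA; last by case: ifP.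
case: (eqVneq (nu x) 0) => [->|nux]; first by case: ifP.
by rewrite AB.
Qed.

(** Union bound: if the image of [G] under [psi] contains that of [T] under [psi0], then [psi0]
    followed by the inverse of [psi] is a homomorphism from [T] to [G]. *)
Lemma pr_contains_le (q : R) (psi0 : {ffun V -> W}) (T : {set {set V}}) :
  0 <= q -> (forall psi, 0 <= mu psi) -> (forall psi, mu psi != 0 -> injective psi) ->
  vertex_spread q mu -> injective psi0 ->
  pr mu [set psi : {ffun V -> W} | edge_image psi0 T \subset edge_image psi G] <=
    #|homs G T|%:R * q ^+ #|cover T|.
Proof.
move=> q0 mu0 muI spr inj0.
pose agree (phi : {ffun V -> V}) : {set {ffun V -> W}} :=
  [set psi : {ffun V -> W} | [forall v in cover T, psi (phi v) == psi0 v]].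
have hagree (phi : {ffun V -> V}) : pr mu (agree phi) <= q ^+ #|cover T|.
  pose x (i : 'I_#|cover T|) := phi (enum_val i).
  pose y (i : 'I_#|cover T|) := psi0 (enum_val i).
  have yI : injective y by move=> i j /inj0 /enum_val_inj.
  (* If [phi] identifies two covered vertices, the event is empty because [psi0] is injective. *)
  have [/injectiveP xI|nxI] := boolP (injectiveb x).
    apply: le_trans (spr _ x y (max_card _) xI yI); apply: pr_le => // psi _.
    rewrite !inE => /forallP h; apply/forallP => i.
    by have := h (enum_val i); rewrite enum_valP.
  rewrite /pr big_pred0 ?exprn_ge0 // => psi; rewrite inE.
  apply/negbTE; apply: contra nxI => /forallP h; apply/injectiveP => i j xij.
  apply: yI; have := h (enum_val i); have := h (enum_val j).
  by rewrite !enum_valP /= -/(x i) -/(x j) xij /y => /eqP <- /eqP.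
apply: (@le_trans _ _ (\sum_(phi in homs G T) pr mu (agree phi))); last first.
  rewrite (le_trans (ler_sum _ (fun phi _ => hagree phi))) //.
  by rewrite sumr_const mulr_natl.
rewrite /pr (exchange_big_dep predT) //= big_mkcond /=; apply: ler_sum => psi _.
case: ifPn => [h|_]; last by rewrite sumr_ge0.
have [->|mupsi] := eqVneq (mu psi) 0; first by rewrite sumr_ge0.
have injpsi := muI _ mupsi; rewrite inE in h.
(* The default of [odflt] is never taken on the cover: there [psi0 v] lies in the image of some edge
   under [psi]. *)
pose phi := [ffun v => if v \in cover T
  then odflt v [pick w | psi w == psi0 v] else v].
have phiE v : v \in cover T -> psi (phi v) = psi0 v.
  move=> vT; rewrite ffunE vT; case: pickP => [w /eqP //|nw].
  case/bigcupP: vT => e eT ve.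
  have /imsetP[f fG ef] := subsetP h _ (mem_edge_image psi0 eT).
  have : psi0 v \in psi @: f by rewrite -ef imset_f.
  by case/imsetP=> w _ vw; have := nw w; rewrite vw eqxx.
rewrite (bigD1 phi) /= ?lerDl ?sumr_ge0 //.
apply/andP; split; last by rewrite inE; apply/forallP => v; apply/implyP => /phiE ->.
apply/homsP; split=> [v vT|e eT]; first by rewrite ffunE (negbTE vT).
have /imsetP[f fG ef] := subsetP h _ (mem_edge_image psi0 eT).
suff -> : phi @: e = f by [].
apply: (imset_inj injpsi); rewrite -ef -imset_comp; apply: eq_in_imset => v ve /=.
by rewrite phiE // (mem_cover eT).
Qed.

End VertexSpread.

(** * The generating function of containment probabilities *)

Section Generating.
Context {R : realType} {V W : finType} (d alpha eps C' : R) (k Delta : nat).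
Context (G : {set {set V}}) (mu : {ffun V -> W} -> R).
Context (k2 : (2 <= k)%N) (kG : k_uniform k G) (d0 : 0 < d) (C'0 : 0 < C')
  (degG : degenerate_with d alpha eps G) (maxG : (max_degree G <= Delta)%N)
  (V0 : (0 < #|V|)%N).

(** Costs per edge: [Delta.+1 * k ^ k] for homomorphisms (the successor keeps it positive),
    [(1 + C') ^+ k] for the at most [k] vertices, and a power of 2 that supplies both the weight [y]
    of the exploration and a spare [2^-1]. *)
Definition spread_const (k Delta : nat) (C' : R) : R :=
  (Delta.+1 * k ^ k)%:R * (1 + C') ^+ k * 2 ^+ (k * Delta).+1.

Let N : R := #|V|%:R.
Let K0 := spread_const k Delta C'.
Let x := N `^ d^-1 / K0.
Let u := N `^ (- (alpha / d)).
Let y : R := 2^-1 ^+ (k * Delta).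

Lemma spread_const_gt0 : 0 < K0.
Proof.
rewrite /K0 /spread_const !mulr_gt0 ?exprn_gt0 ?ltr0n ?addr_gt0 //.
by rewrite muln_gt0 /= expn_gt0 (ltn_trans _ k2).
Qed.

(** With [v] covered vertices and [m] edges, [N] has exponent [1 - v + m / d]. For a small cover
    this is at most [- (alpha / d)]; for a large one it is at most 0, and the many edges make
    [2^-1 ^+ m] small. *)
Lemma powR_cover_le (C : {set {set V}}) : C \subset G -> C != set0 ->
  (forall m : nat, eps * N < (k * m)%:R -> 2^-1 ^+ m <= u) ->
  N * N ^- #|cover C| * (N `^ d^-1) ^+ #|C| * 2^-1 ^+ #|C| <= u.
Proof.
move=> CG C0 tail.
have N1 : 1 <= N by rewrite /N ler1n.
have N0 : 0 < N by rewrite (lt_le_trans ltr01).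
have -> : N * N ^- #|cover C| * (N `^ d^-1) ^+ #|C| =
    N `^ (1 - #|cover C|%:R + #|C|%:R / d).
  rewrite !powRD ?(gt_eqF N0) ?implybT // powRr1 ?ltW // powRN powR_mulrn ?ltW //.
  by rewrite -[in LHS](powR_mulrn _ (powR_ge0 _ _)) -powRrM [d^-1 * _]mulrC.
have half m : 2^-1 ^+ m <= 1 :> R by rewrite exprn_ile1 ?invr_ge0 ?invf_le1 ?ler1n.
have [small|large] := lerP #|cover C|%:R (eps * N).
  apply: (@le_trans _ _ (u * 1)); last by rewrite mulr1.
  rewrite ler_pM ?powR_ge0 ?exprn_ge0 ?invr_ge0 //.
  have h := card_edges_le_small k2 kG degG CG C0 small.
  rewrite ler_powR // -subr_ge0 (_ : _ - _ = (d * (#|cover C|%:R - 1) - alpha - #|C|%:R) / d).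
    by rewrite divr_ge0 ?subr_ge0 ?(ltW d0).
  by field; rewrite gt_eqF.
apply: (@le_trans _ _ (1 * u)); last by rewrite mul1r.
rewrite ler_pM ?powR_ge0 ?exprn_ge0 ?invr_ge0 //.
  have h := card_edges_le k2 kG degG CG C0.
  rewrite -[leRHS](powRr0 N) ler_powR // -subr_ge0.
  rewrite (_ : _ - _ = (d * (#|cover C|%:R - 1) - #|C|%:R) / d).
    by rewrite divr_ge0 ?subr_ge0 ?(ltW d0).
  by field; rewrite gt_eqF.
by apply: tail; apply: lt_le_trans large _; rewrite ler_nat (card_cover_le kG).
Qed.

(** The factor [K0 ^- #|C|] inside [x ^+ #|C|] cancels all costs per edge; [u] comes from
    [powR_cover_le], and [y ^+ #|C|] is kept for summing over connected sets. *)
Lemma connected_weight_le e (C : {set {set V}}) : C \subset G -> e \in C ->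
  reach (meet_in G) [set e] C ->
  (forall m : nat, eps * N < (k * m)%:R -> 2^-1 ^+ m <= u) ->
  #|homs G C|%:R * (C' / N) ^+ #|cover C| * x ^+ #|C| <= u * y ^+ #|C|.
Proof.
move=> CG eC rC tail.
have k0 : (0 < k)%N by apply: ltn_trans k2.
have C0 : C != set0 by apply/set0Pn; exists e.
have N0 : 0 < N by rewrite /N ltr0n.
have homsC : #|homs G C|%:R <= N * (Delta.+1 * k ^ k)%:R ^+ #|C|.
  rewrite /N -natrX -natrM ler_nat.
  rewrite (leq_trans (card_homs_connected k0 kG CG eC rC)) // leq_mul2l leq_exp2r ?orbT.
    by rewrite leq_mul2r (leq_trans maxG) ?orbT.
  by rewrite card_gt0.
have C1 : 1 <= 1 + C' by rewrite lerDl ltW.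
have C'v : C' ^+ #|cover C| <= (1 + C') ^+ (k * #|C|).
  rewrite (le_trans (_ : _ <= (1 + C') ^+ #|cover C|)) //.
    by rewrite lerXn2r ?nnegrE ?addr_ge0 ?(ltW C'0) ?lerDr.
  by rewrite ler_weXn2l // (card_cover_le kG).
have step := powR_cover_le CG C0 tail.
have K0E : K0 ^+ #|C| = (Delta.+1 * k ^ k)%:R ^+ #|C| * (1 + C') ^+ (k * #|C|) *
    (y^-1 ^+ #|C| * (2^-1 ^+ #|C|)^-1).
  rewrite /K0 /spread_const !exprMn exprM; congr (_ * _).
  rewrite -exprVn invrK /y -exprVn invrK -!exprM -exprD.
  by congr (_ ^+ _); lia.
have y0 : 0 < y by rewrite exprn_gt0 // invr_gt0.
have L0 : 0 < (Delta.+1 * k ^ k)%:R :> R by rewrite ltr0n muln_gt0 /= expn_gt0 k0.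
apply: (@le_trans _ _ ((N * (Delta.+1 * k ^ k)%:R ^+ #|C|) *
    ((1 + C') ^+ (k * #|C|) * N ^- #|cover C|) * x ^+ #|C|)).
  rewrite ler_wpM2r ?exprn_ge0 ?divr_ge0 ?powR_ge0 ?(ltW spread_const_gt0) //.
  rewrite ler_pM ?ler0n ?exprn_ge0 ?divr_ge0 ?(ltW C'0) ?(ltW N0) //.
  by rewrite exprMn exprVn ler_wpM2r ?invr_ge0 ?exprn_ge0 ?(ltW N0).
apply: (@le_trans _ _ ((N * N ^- #|cover C| * (N `^ d^-1) ^+ #|C| * 2^-1 ^+ #|C|)
    * y ^+ #|C|)); last by rewrite ler_wpM2r // exprn_ge0 // ltW.
rewrite le_eqVlt; apply/orP; left; apply/eqP.
rewrite /x exprMn (exprVn K0) K0E (exprVn y).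
have h1 : (Delta.+1 * k ^ k)%:R ^+ #|C| != 0 :> R by rewrite expf_neq0 // gt_eqF.
have h2 : (1 + C') ^+ (k * #|C|) != 0 by rewrite expf_neq0 // gt_eqF // (lt_le_trans ltr01).
have h3 : y ^+ #|C| != 0 by rewrite expf_neq0 // gt_eqF.
have h4 : 2^-1 ^+ #|C| != 0 :> R by rewrite expf_neq0 // invr_eq0.
have h5 : N ^+ #|cover C| != 0 :> R by rewrite expf_neq0 // gt_eqF.
move: h1 h2 h3 h4 h5; set a1 := _ ^+ _; set a2 := _ ^+ _; set a3 := _ ^+ _.
set a4 := _ ^+ _; set a5 := _ ^+ _; move: ((N `^ d^-1) ^+ _) => a6 *.
by field; do ?[apply/andP; split].
Qed.

Lemma sum_homs_le (S : {set {set V}}) : S \subset G ->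
  (forall m : nat, eps * N < (k * m)%:R -> 2^-1 ^+ m <= u) ->
  \sum_(T : {set {set V}} | T \subset S)
    #|homs G T|%:R * (C' / N) ^+ #|cover T| * x ^+ #|T| <= (1 + u) ^+ #|S|.
Proof.
move=> SG tail.
have x0 : 0 <= x by rewrite divr_ge0 ?powR_ge0 ?(ltW spread_const_gt0).
have q0 : 0 <= C' / N by rewrite divr_ge0 ?ler0n ?(ltW C'0).
have y0 : 0 <= y by rewrite exprn_ge0 // invr_ge0.
have u0 : 0 <= u by exact: powR_ge0.
apply: (sum_components_le (adj := meet_in G) (U := G)
  (b := fun C => u * y ^+ #|C|)) => //.
- exact: meet_in_sym.
- by move=> T; rewrite !mulr_ge0 ?ler0n ?exprn_ge0.
- by move=> C; rewrite mulr_ge0 ?exprn_ge0.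
- rewrite /cover big_set0 !cards0 !expr0 !mulr1 -[leRHS](mulr1n 1) ler_nat.
  exact: card_homs0.
- move=> e C T eC rC CTG dCT nadj.
  have [CG TG] : C \subset G /\ T \subset G.
    by apply/andP; rewrite -subUset.
  (* Nonadjacent edges of [G] share no vertex, so the vertex counts add up. *)
  have dcover : [disjoint cover C & cover T].
    apply/pred0P => v /=; apply/negbTE/negP => /andP[/bigcupP[f fC vf] /bigcupP[g gT vg]].
    have /negP[] := nadj f g fC gT; rewrite /meet_in (subsetP CG) // (subsetP TG) //=.
    by rewrite -setI_eq0; apply/set0Pn; exists v; rewrite inE vf.
  apply: (@le_trans _ _ ((#|homs G C|%:R * (C' / N) ^+ #|cover C| * x ^+ #|C|) *
      (#|homs G T|%:R * (C' / N) ^+ #|cover T| * x ^+ #|T|))); last first.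
    rewrite ler_wpM2r ?connected_weight_le //; last exact: (connected_weight_le CG eC).
    by rewrite !mulr_ge0 ?ler0n ?exprn_ge0.
  rewrite coverU !cardsU.
  move: dCT dcover; rewrite -!setI_eq0 => /eqP -> /eqP ->.
  rewrite !cards0 !subn0 !exprD.
  rewrite (_ : forall p q r p' q' r' : R, p * q * r * (p' * q' * r') =
    (p * p') * (q * q') * (r * r')); last by move=> *; ring.
  rewrite ler_wpM2r ?mulr_ge0 ?exprn_ge0 // ler_wpM2r ?mulr_ge0 ?exprn_ge0 //.
  by rewrite -natrM ler_nat card_homsU.
- move=> e eG; rewrite -mulr_sumr ler_piMr //.
  have := @sum_reach_le R _ (meet_in G) (k * Delta) y G [set e] _ y0 _.
  rewrite cards1 expr1 => h.
  have {}h : \sum_(C : {set {set V}} | (C \subset G) && reach (meet_in G) [set e] C)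
      y ^+ #|C| <= 2.
    apply: h => [f|].
      by rewrite (leq_trans (card_meet_in f kG)) // leq_mul2l maxG orbT.
    by rewrite /y -exprMn mulVf // expr1n.
  (* The bound 2 includes the term 1 of the empty set, which does not contain [e]. *)
  move: h; rewrite (bigD1 set0) /=; last first.
    rewrite sub0set; apply/reachP => X; rewrite subset0 => /eqP ->.
    by rewrite eqxx.
  rewrite cards0 expr0 -lerBrDl => h.
  apply: (@le_trans _ _ (2 - 1)); last by rewrite lerBlDr.
  apply: le_trans h; rewrite big_mkcond [leRHS]big_mkcond; apply: ler_sum => C _.
  case: ifPn => [/and3P[CG eC rC]|_]; last by case: ifP => // _; rewrite exprn_ge0.
  by rewrite CG rC /=; case: eqP eC => [->|//]; rewrite inE.
Qed.

Lemma sum_contains_le (psi0 : {ffun V -> W}) (S : {set {set W}}) :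
  (forall psi, 0 <= mu psi) -> \sum_psi mu psi = 1 ->
  (forall psi, mu psi != 0 -> injective psi) ->
  vertex_spread (C' / N) mu -> injective psi0 -> S \subset edge_image psi0 G ->
  (forall m : nat, eps * N < (k * m)%:R -> 2^-1 ^+ m <= u) ->
  \sum_(T : {set {set W}} | (T \subset S) && (T != set0))
    (\sum_(psi : {ffun V -> W} | T \subset edge_image psi G) mu psi) * x ^+ #|T|
  <= (1 + u) ^+ #|S| - 1.
Proof.
move=> mu0 mu1 muI spr inj0 /sub_edge_image[S0 S0G ->] tail.
have x0 : 0 <= x by rewrite divr_ge0 ?powR_ge0 ?(ltW spread_const_gt0).
have q0 : 0 <= C' / N by rewrite divr_ge0 ?ler0n ?(ltW C'0).
(* The total mass is the term of the empty set, accounting for the subtracted 1. *)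
have E1 : 1 = (\sum_(psi : {ffun V -> W} | set0 \subset edge_image psi G) mu psi)
    * x ^+ #|(set0 : {set {set W}})| :> R.
  rewrite cards0 mulr1 -mu1; apply: eq_bigl => psi.
  by rewrite sub0set.
rewrite lerBrDl [X in X + _ <= _]E1 card_edge_image //.
rewrite (_ : _ + _ = \sum_(T : {set {set W}} | T \subset edge_image psi0 S0)
  (\sum_(psi : {ffun V -> W} | T \subset edge_image psi G) mu psi) * x ^+ #|T|); last first.
  by rewrite [RHS](bigD1 set0) ?sub0set.
apply: le_trans (sum_homs_le S0G tail).
rewrite (reindex_onto (fun T => edge_image psi0 T)
   (fun T => [set e in S0 | psi0 @: (e : {set V}) \in T])) /=; last first.
  move=> T /sub_edge_image[T0 T0S ->]; apply/setP => f; apply/imsetP/imsetP.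
    case=> e; rewrite inE => /andP[eS /imsetP[e' e'T ee']] ->.
    by exists e' => //.
  case=> e eT ->; exists e => //.
  by rewrite inE (subsetP T0S) // mem_edge_image.
rewrite big_mkcond [leRHS]big_mkcond; apply: ler_sum => T _.
case: ifPn => [/andP[_ /eqP Tdef]|_]; last first.
  by case: ifP => // _; rewrite !mulr_ge0 ?ler0n ?exprn_ge0.
have -> : T \subset S0 by rewrite -Tdef; apply/subsetP => e; rewrite inE => /andP[].
rewrite card_edge_image // ler_wpM2r ?exprn_ge0 //.
apply: le_trans (pr_contains_le G T q0 mu0 muI spr inj0).
by rewrite /pr (eq_bigl _ _ (fun psi => in_set _ psi)).
Qed.

End Generating.

(** * Expectations over binomial random subsets *)

Section SubsetMean.
Context {R : realType} {T : finType}.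
Implicit Types (D S W X Z : {set T}) (p : R) (f : {set T} -> R).

(** For [W \subset D], the probability that a random subset of [D] of density [p] equals [W]. *)
Definition subset_weight D p W : R := p ^+ #|W| * (1 - p) ^+ #|D :\: W|.

Definition subset_mean D p f : R :=
  \sum_(W : {set T} | W \subset D) subset_weight D p W * f W.

Lemma subset_weight_ge0 D p W : 0 <= p <= 1 -> 0 <= subset_weight D p W.
Proof. by case/andP=> p0 p1; rewrite mulr_ge0 ?exprn_ge0 ?subr_ge0. Qed.

Lemma subset_mean_le D p f g : 0 <= p <= 1 ->
  (forall W, W \subset D -> f W <= g W) -> subset_mean D p f <= subset_mean D p g.
Proof.
move=> p01 fg; apply: ler_sum => W WD.
by rewrite ler_wpM2l ?fg // subset_weight_ge0.
Qed.

Lemma subset_meanD D p f g :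
  subset_mean D p (fun W => f W + g W) = subset_mean D p f + subset_mean D p g.
Proof. by rewrite /subset_mean -big_split; apply: eq_bigr => W _; rewrite mulrDr. Qed.

Lemma subset_meanZ D p a f :
  subset_mean D p (fun W => a * f W) = a * subset_mean D p f.
Proof. by rewrite /subset_mean big_distrr; apply: eq_bigr => W _ /=; rewrite mulrCA. Qed.

Lemma eq_subset_mean D p f g : f =1 g -> subset_mean D p f = subset_mean D p g.
Proof. by move=> fg; apply: eq_bigr => W _; rewrite fg. Qed.

Lemma subset_mean_rec D p f q : q \in D ->
  subset_mean D p f =
  (1 - p) * subset_mean (D :\ q) p f + p * subset_mean (D :\ q) p (fun W => f (q |: W)).
Proof.
move=> qD; rewrite /subset_mean.
have := sum_subset_split (fun W => subset_weight D p W * f W) xpredT qD.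
under eq_bigl do rewrite andbT; under [X in _ = X + _]eq_bigl do rewrite andbT.
under [X in _ = _ + X]eq_bigl do rewrite andbT.
move=> ->; rewrite !big_distrr /=; congr (_ + _); apply: eq_bigr => W;
  rewrite subsetD1 => /andP[WD qW]; rewrite !mulrA; congr (_ * _); rewrite /subset_weight.
  rewrite -mulrA mulrCA -exprS; congr (_ * _ ^+ _).
  rewrite (cardsD1 q (D :\: W)) inE qW qD add1n; congr (_.+1).
  by apply: eq_card => z; rewrite !inE; do !case: (_ == _) => //=; rewrite ?andbF.
rewrite cardsU1 qW add1n -exprS; congr (_ * _ ^+ _).
by apply: eq_card => z; rewrite !inE negb_or -andbA andbCA.
Qed.

Lemma subset_mean0 p f : subset_mean set0 p f = f set0.
Proof.
rewrite /subset_mean (big_pred1 set0) => [|W]; last by rewrite subset0.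
by rewrite /subset_weight set0D !cards0 !expr0 !mul1r.
Qed.

Lemma subset_mean_cst D p a : subset_mean D p (fun=> a) = a.
Proof.
have [n] := ubnP #|D|; elim: n => // n IH in D *; rewrite ltnS => Dn.
have [->|/set0Pn[q qD]] := eqVneq D set0; first by rewrite subset_mean0.
rewrite (subset_mean_rec _ _ qD) !IH; try by rewrite (leq_trans _ Dn) // (cardsD1 q D) qD.
by ring.
Qed.

(** Two-round exposure: an element escapes both independent rounds with probability
    [(1 - p1) * (1 - p2)]. *)
Lemma subset_mean_setU D p1 p2 f :
  subset_mean D p1 (fun W1 => subset_mean D p2 (fun W2 => f (W1 :|: W2))) =
  subset_mean D (1 - (1 - p1) * (1 - p2)) f.
Proof.
have [n] := ubnP #|D|; elim: n => // n IH in D f *; rewrite ltnS => Dn.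
have [->|/set0Pn[q qD]] := eqVneq D set0; first by rewrite !subset_mean0 setU0.
have Dn' : (#|D :\ q| < n)%N by rewrite (leq_trans _ Dn) // (cardsD1 q D) qD.
rewrite !(subset_mean_rec _ _ qD).
under eq_subset_mean => W1 do rewrite (subset_mean_rec _ _ qD).
under [X in _ + _ * X]eq_subset_mean => W1 do rewrite (subset_mean_rec _ _ qD).
rewrite !subset_meanD !subset_meanZ -!IH //.
(* The element [q] is selected in the second round only, in the first only, or in both; each time it
   is moved out of the union. *)
under [X in _ * (_ + _ * X)]eq_subset_mean => W1.
  under eq_subset_mean => W2 do rewrite setUCA.
  over.
under [X in _ + _ * (_ * X + _)]eq_subset_mean => W1.
  under eq_subset_mean => W2 do rewrite -setUA.
  over.
under [X in _ + _ * (_ + _ * X)]eq_subset_mean => W1.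
  under eq_subset_mean => W2 do rewrite -setUUr.
  over.
by ring.
Qed.

End SubsetMean.

(** * Minimal remainders after one round of exposure *)

Section Fragments.
Context {R : realType} {T I : finType}.
Implicit Types (D S W X Z : {set T}) (nu : I -> R) (A : I -> {set T}) (p x u : R).

(** This form is inherited when the sets [A i] shrink and mass is deleted, which is what each round
    does; hence [nu] is not normalised. *)
Definition spread_family x u nu A : Prop :=
  forall i S, nu i != 0 -> S \subset A i ->
    \sum_(X : {set T} | (X \subset S) && (X != set0))
      (\sum_(i' | X \subset A i') nu i') * x ^+ #|X| <= (1 + u) ^+ #|S| - 1.

Definition fragment_index nu A W (i : I) : I :=
  [arg min_(i' < i | (nu i' != 0) && (A i' :\: W \subset A i)) #|A i' :\: W|].

Definition fragment nu A W (i : I) : {set T} := A (fragment_index nu A W i) :\: W.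

Lemma fragmentP nu A W i : nu i != 0 ->
  [/\ nu (fragment_index nu A W i) != 0, fragment nu A W i \subset A i &
      forall i', nu i' != 0 -> A i' :\: W \subset A i ->
        (#|fragment nu A W i| <= #|A i' :\: W|)%N].
Proof.
move=> nui; rewrite /fragment /fragment_index.
case: arg_minnP => [|i' /andP[h1 h2] h3]; first by rewrite nui subsetDl.
by split=> // j nuj Aj; apply: h3; rewrite nuj Aj.
Qed.

(** The choice depends on [Z] alone, so for [Z = W :|: X] the remainder [X] is sought among subsets
    of one set that does not depend on [W]. *)
Definition chosen nu A Z : {set T} :=
  if [pick i | (nu i != 0) && (A i \subset Z)] is Some i then A i else set0.

(* The chosen member of [W :|: X] leaves a remainder inside the minimal fragment
   [X], hence equal to [X]. *)
Lemma fragment_sub_chosen nu A W i : nu i != 0 ->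
  fragment nu A W i \subset chosen nu A (W :|: fragment nu A W i).
Proof.
move=> nui; have [nuf fA minf] := fragmentP A W nui.
rewrite /chosen; case: pickP => [i' /andP[nui' Ai']|/(_ (fragment_index nu A W i))].
  have sub : A i' :\: W \subset fragment nu A W i by rewrite subDset.
  have /eqP <- : A i' :\: W == fragment nu A W i.
    by rewrite eqEcard sub minf // (subset_trans sub).
  exact: subsetDl.
rewrite nuf /= /fragment => /negbT/negP[].
by rewrite -subDset.
Qed.

(** The powers of [p] agree, and removing [X] from [Z] only raises the exponent of [1 - p]. *)
Lemma subset_weightD D p X Z : 0 < p <= 1 -> X \subset Z -> Z \subset D ->
  subset_weight D p (Z :\: X) * p ^+ #|X| <= subset_weight D p Z.
Proof.
move=> /andP[p0 p1] XZ ZD; rewrite /subset_weight mulrAC -exprD.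
have -> : (#|Z :\: X| + #|X| = #|Z|)%N.
  by rewrite cardsD (setIidPr XZ) subnK ?subset_leq_card.
rewrite ler_wpM2l ?exprn_ge0 ?(ltW p0) // ler_wiXn2l ?subr_ge0 ?lerBlDr ?lerDl ?(ltW p0) //.
by apply/subset_leq_card/setDS/subsetDl.
Qed.

(** Double counting of pairs [(W, X)] through [Z = W :|: X]: passing from the weight of [W] to that
    of [Z] costs [p ^- #|X|], and [X] ranges over subsets of the chosen member of [Z], where the
    spread bound applies. *)
Lemma mean_large_fragment_le D p x u nu A (j j' : R) :
  0 < p <= 1 -> 0 <= x -> expR 2 <= p * x -> 0 <= u -> 0 <= j -> 0 <= j' ->
  (forall i, 0 <= nu i) -> (forall i, nu i != 0 -> A i \subset D) ->
  (forall i, nu i != 0 -> #|A i|%:R <= j) -> spread_family x u nu A ->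
  subset_mean D p (fun W => \sum_(i | j' < #|fragment nu A W i|%:R) nu i) <=
    expR (- (2 * j')) * (expR (u * j) - 1).
Proof.
move=> p01 x0 px u0 j0 j'0 nu0 AD Aj spr; have /andP[p0 p1] := p01.
pose big X := j' < #|X|%:R :> R.
pose s W X : R := \sum_(i | fragment nu A W i == X) nu i.
pose m X : R := \sum_(i | X \subset A i) nu i.
pose g : R := expR (u * j) - 1.
have s0 W X : 0 <= s W X by exact: sumr_ge0.
have m0 X : 0 <= m X by exact: sumr_ge0.
have p01' : 0 <= p <= 1 by rewrite ltW.
have w0 W := subset_weight_ge0 D W p01'.
have -> : subset_mean D p (fun W => \sum_(i | j' < #|fragment nu A W i|%:R) nu i) =
    \sum_(X | big X) \sum_(W : {set T} | W \subset D) subset_weight D p W * s W X.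
  rewrite exchange_big; apply: eq_bigr => W _ /=; rewrite -mulr_sumr; congr (_ * _).
  rewrite (partition_big (fragment nu A W) big) //=.
  apply: eq_bigr => X bX; apply: eq_bigl => i.
  by case: eqP => [->|]; rewrite ?andbF // -/(big X) bX.
have key X : \sum_(W : {set T} | W \subset D) subset_weight D p W * s W X <=
    \sum_(Z : {set T} | Z \subset D)
       (if X \subset chosen nu A Z then subset_weight D p Z * p ^- #|X| * m X else 0).
  (* A remainder is disjoint from the exposed set, so only [W] disjoint from [X] contribute, and [Z]
     determines them. *)
  rewrite (bigID (fun W => [disjoint W & X])) /= [X in _ + X]big1 ?addr0; last first.
    move=> W /andP[_ dWX]; rewrite /s big_pred0 ?mulr0 // => i.
    apply: contraNF dWX => /eqP <-; rewrite /fragment -setI_eq0.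
    by apply/eqP/setP => z; rewrite !inE; case: (z \in W).
  rewrite (reindex_onto (fun Z => Z :\: X) (fun W => W :|: X)) /=; last first.
    by move=> W /andP[_ dWX]; rewrite setDUl setDv setU0; apply/setDidPl.
  rewrite big_mkcond [leRHS]big_mkcond; apply: ler_sum => Z _ /=.
  have R0 : 0 <= (if Z \subset D then if X \subset chosen nu A Z then
      subset_weight D p Z * p ^- #|X| * m X else 0 else 0 : R).
    by do 2!case: ifP => // _; rewrite !mulr_ge0 ?invr_ge0 ?exprn_ge0 ?(ltW p0) ?subr_ge0.
  case: ifPn => // /andP[/andP[ZXD _] /eqP ZX].
  have XZ : X \subset Z by rewrite -ZX subsetUr.
  have [/existsP[i /andP[nui /eqP fi]]|none] :=
    boolP [exists i, (nu i != 0) && (fragment nu A (Z :\: X) i == X)]; last first.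
    rewrite /s big1 ?mulr0 // => i fi; apply/eqP; apply: contraNT none => nui.
    by apply/existsP; exists i; rewrite nui.
  have [_ fA _] := fragmentP A (Z :\: X) nui; rewrite fi in fA.
  have ZD : Z \subset D by rewrite -ZX subUset ZXD (subset_trans fA) // AD.
  have Xch : X \subset chosen nu A Z.
    by have := fragment_sub_chosen A (Z :\: X) nui; rewrite fi ZX.
  rewrite ZD Xch ler_pM //.
    by rewrite ler_pdivlMr ?exprn_gt0 // subset_weightD.
  rewrite /s /m big_mkcond [leRHS]big_mkcond; apply: ler_sum => i' _.
  case: (eqVneq (nu i') 0) => [->|nui']; first by do 2!case: ifP.
  case: ifP => [/eqP fi'|_]; last by case: ifP.
  case: ifPn => // /negP[].
  by have [_ + _] := fragmentP A (Z :\: X) nui'; rewrite fi'.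
apply: (le_trans (ler_sum _ (fun X _ => key X))).
rewrite exchange_big /=.
rewrite -[leRHS](subset_mean_cst D p); apply: ler_sum => Z ZD.
(* Since [expR 2 <= p * x], each [p ^- #|X|] is at most [expR (- (2 * #|X|)) * x ^+ #|X|], and
   [#|X|] exceeds [j']. *)
apply: (@le_trans _ _ (\sum_(X : {set T} | (X \subset chosen nu A Z) && (X != set0))
    subset_weight D p Z * (expR (- (2 * j')) * (m X * x ^+ #|X|)))).
  rewrite big_mkcond [leRHS]big_mkcond; apply: ler_sum => X _.
  have R0 : 0 <= subset_weight D p Z * (expR (- (2 * j')) * (m X * x ^+ #|X|)).
    by rewrite !mulr_ge0 ?expR_ge0 ?exprn_ge0 ?subr_ge0 ?(ltW p0).
  case: ifPn => bX; last by case: ifP.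
  case: ifPn => Xch; last by do ?case: ifP.
  have X0 : X != set0.
    rewrite -card_gt0 -(ltr0n R); exact: le_lt_trans bX.
  rewrite X0 /= -mulrA ler_wpM2l // [p ^- _ * _]mulrC mulrCA ler_wpM2l //.
  rewrite expRN mulrC ler_pdivlMr ?expR_gt0 // mulrC ler_pdivrMr ?exprn_gt0 //.
  rewrite mulrC -exprMn; apply: (@le_trans _ _ (expR 2 ^+ #|X|)); last first.
    by rewrite lerXn2r ?nnegrE ?expR_ge0 ?mulr_ge0 ?(ltW p0) // mulrC.
  by rewrite -expRM_natr mulrC ler_expR ler_wpM2l // ltW.
rewrite -mulr_sumr ler_wpM2l // -mulr_sumr ler_wpM2l ?expR_ge0 //.
(* The default [set0] has no nonempty subset; a genuine member has at most [j] elements. *)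
rewrite /chosen; case: pickP => [i /andP[nui _]|_]; last first.
  rewrite big_pred0 ?subr_ge0 => [|X]; last by rewrite subset0 andbN.
  by rewrite -[leLHS]expR0 ler_expR mulr_ge0.
apply: (le_trans (spr i (A i) nui (subxx _))); rewrite lerB //.
apply: (@le_trans _ _ (expR u ^+ #|A i|)).
  by rewrite lerXn2r ?nnegrE ?addr_ge0 ?expR_ge0 ?expR_ge1Dx.
by rewrite -expRM_natr ler_expR ler_wpM2l // Aj.
Qed.

End Fragments.

(** * Iterating the rounds until every remainder is empty *)

Section Covering.
Context {R : realType}.

Lemma expR_sub1_le (s : R) : expR s - 1 <= s * expR s.
Proof.
have := expR_ge1Dx (- s); rewrite expRN => h.
have e0 := expR_gt0 s.
have : (1 - s) * expR s <= 1 by rewrite -ler_pdivlMr // div1r.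
by rewrite mulrBl mul1r lerBlDr => ?; rewrite lerBlDr addrC.
Qed.

(** The previous bound leaves [v * t * expR (- t)], and [t <= expR t]. *)
Lemma decay_le (v t : R) : 0 <= v <= 1 -> 0 <= t ->
  expR (- (2 * t)) * (expR (v * t) - 1) <= v.
Proof.
move=> /andP[v0 v1] t0.
apply: (@le_trans _ _ (expR (- (2 * t)) * ((v * t) * expR t))).
  rewrite ler_wpM2l ?expR_ge0 // (le_trans (expR_sub1_le _)) //.
  by rewrite ler_wpM2l ?mulr_ge0 // ler_expR ler_piMl.
rewrite mulrC -!mulrA -expRD.
have -> : t - 2 * t = - t by ring.
rewrite ler_piMr // expRN ler_pdivrMr ?expR_gt0 // mul1r.
by rewrite (le_trans _ (expR_ge1Dx t)) // lerDr.
Qed.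

Context {T I : finType}.
Implicit Types (D W : {set T}) (nu : I -> R) (A : I -> {set T}).

Definition missed nu A W : R := [forall i, (nu i != 0) ==> ~~ (A i \subset W)]%:R.

(** A fragment inside [W2] is some [A i' :\: W1] with [A i'] of positive mass, which puts [A i']
    inside [W1 :|: W2]. The predicate [P] selects the survivors of the round. *)
Lemma missed_setU nu A W1 W2 (P : pred I) :
  missed nu A (W1 :|: W2) <=
  missed (fun i => if P i then nu i else 0) (fragment nu A W1) W2.
Proof.
rewrite /missed ler_nat; case: forallP => //= h; rewrite lt0b.
apply/forallP => i; case: ifP => Pi; last by rewrite eqxx.
apply/implyP => nui; apply/negP => fW.
have [nuf _ _] := fragmentP A W1 nui.
by have := h (fragment_index nu A W1 i); rewrite nuf /= -subDset fW.
Qed.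

(* The density [p] is spent in [m] rounds of density [p1]; each round shrinks all
   but a [v]-fraction of the fragments from size at most [j] to at most [j * v]. *)
Lemma mean_missed_le (D : {set T}) (p1 x v : R) (m : nat) (p j : R) nu A :
  0 < p1 < 1 -> 0 <= x -> expR 2 <= p1 * x -> 0 <= v <= 1 ->
  0 <= p <= 1 -> m%:R * p1 <= p -> 0 <= j -> j * v ^+ m < 1 ->
  (forall i, 0 <= nu i) -> (forall i, nu i != 0 -> A i \subset D) ->
  (forall i, nu i != 0 -> #|A i|%:R <= j) -> spread_family x (v ^+ 2) nu A ->
  (\sum_i nu i) * subset_mean D p (missed nu A) <= m%:R * v.
Proof.
move=> /andP[p10 p11] x0 px v01; have /andP[v0 v1] := v01.
elim: m p j nu A => [|m IH] p j nu A p01 mp j0 jv nu0 AD Aj spr.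
  (* With no rounds left, [j < 1] makes every member empty, hence never missed, unless there is no
     mass at all. *)
  rewrite mul0r; have [nz|/existsPn z] := boolP [exists i, nu i != 0]; last first.
    by rewrite big1 ?mul0r // => i _; apply/eqP; rewrite -[_ == _]negbK.
  rewrite (_ : subset_mean _ _ _ = 0) ?mulr0 //.
  rewrite /subset_mean big1 // => W WD; rewrite /missed.
  case: forallP => [h|_]; last by rewrite mulr0.
  case/existsP: nz => i nui; have := h i; rewrite nui /=.
  suff -> : A i = set0 by rewrite sub0set.
  apply/eqP; rewrite -cards_eq0 -leqn0 -ltnS -(ltr_nat R).
  by rewrite (le_lt_trans (Aj i nui)) // -[j]mulr1.
have /andP[p0 p1'] := p01.
have q10 : 0 < 1 - p1 by rewrite subr_gt0.
have p1p : p1 <= p.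
  by apply: le_trans mp; rewrite ler_peMl ?(ltW p10) // ler1n.
(* The density left for the remaining rounds, by two-round exposure; it is at least [p - p1]. *)
pose p2 := (p - p1) / (1 - p1).
have p2E : p = 1 - (1 - p1) * (1 - p2).
  by rewrite /p2; field; rewrite gt_eqF.
have p201 : 0 <= p2 <= 1.
  by rewrite /p2 divr_ge0 ?subr_ge0 ?(ltW p11) //= ler_pdivrMr // mul1r lerD2r.
have mp2 : m%:R * p1 <= p2.
  rewrite /p2 ler_pdivlMr // -natr1 mulrDl mul1r in mp *.
  rewrite mulrBr mulr1 lerBlDr; apply: (@le_trans _ _ (p - p1)); first by rewrite lerBrDr.
  by rewrite lerDl !mulr_ge0 ?ler0n ?(ltW p10).
(* Large fragments are deleted without renormalising, which is why the total mass appears as a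
   factor in the statement. *)
pose nu' W i := if #|fragment nu A W i|%:R <= j * v then nu i else 0.
have nu'P W i : nu' W i != 0 -> nu i != 0 /\ #|fragment nu A W i|%:R <= j * v.
  by rewrite /nu'; case: ifP => // _; rewrite eqxx.
have j'0 : 0 <= j * v by rewrite mulr_ge0.
have step W : W \subset D ->
    (\sum_i nu' W i) * subset_mean D p2 (missed (nu' W) (fragment nu A W)) <= m%:R * v.
  move=> WD; apply: (IH p2 (j * v)) => //.
  - by rewrite -mulrA -exprS.
  - by move=> i; rewrite /nu'; case: ifP.
  - move=> i /nu'P[nui _]; apply: subset_trans (AD i nui).
    by have [_ +_] := fragmentP A W nui.
  - by move=> i /nu'P[].
  - move=> i S /nu'P[nui _] SA.
    have [_ fA _] := fragmentP A W nui.
    apply: le_trans (spr i S nui (subset_trans SA fA)); apply: ler_sum => X _.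
    rewrite ler_wpM2r ?exprn_ge0 // big_mkcond [leRHS]big_mkcond.
    apply: ler_sum => i' _; rewrite /nu'.
    have [->|nui'] := eqVneq (nu i') 0; first by do ?case: ifP.
    case: ifP => [XA|_]; last by case: ifP.
    have [_ fA' _] := fragmentP A W nui'.
    by rewrite (subset_trans XA fA'); case: ifP.
pose dead W := \sum_(i | j * v < #|fragment nu A W i|%:R) nu i.
have split W : \sum_i nu i = dead W + \sum_i nu' W i.
  rewrite (bigID (fun i => j * v < #|fragment nu A W i|%:R)) /=; congr (_ + _).
  by rewrite big_mkcond; apply: eq_bigr => i _; rewrite -leNgt.
have p1le : 0 <= p1 <= 1 by rewrite !ltW.
have mean01 (f : {set T} -> R) :
    (forall W', 0 <= f W' <= 1) -> 0 <= subset_mean D p2 f <= 1.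
  move=> f01; apply/andP; split.
    apply: sumr_ge0 => W' _; rewrite mulr_ge0 ?subset_weight_ge0 //.
    by have /andP[] := f01 W'.
  rewrite -[leRHS](subset_mean_cst D p2).
  by apply: subset_mean_le => // W' _; have /andP[] := f01 W'.
have missed01 nu1 A1 W' : 0 <= missed nu1 A1 W' <= 1.
  by rewrite /missed ler0n lern1 leq_b1.
rewrite {1}p2E -subset_mean_setU -subset_meanZ.
apply: (@le_trans _ _ (subset_mean D p1 (fun W => dead W + m%:R * v))).
  apply: subset_mean_le => // W WD; rewrite (split W) mulrDl lerD //.
    rewrite ler_piMr //; first exact: sumr_ge0.
    by have /andP[] := mean01 _ (fun W' => missed01 nu A (W :|: W')).
  apply: le_trans (step W WD); rewrite ler_wpM2l //.
    by apply: sumr_ge0 => i _; rewrite /nu'; case: ifP.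
  apply: subset_mean_le => // W2 _.
  exact: (missed_setU nu A W W2 (fun i => #|fragment nu A W i|%:R <= j * v)).
rewrite subset_meanD subset_mean_cst -natr1 mulrDl mul1r addrC lerD2l.
apply: le_trans (mean_large_fragment_le _ x0 px _ j0 j'0 nu0 AD Aj spr) _.
- by rewrite p10 ltW.
- by rewrite exprn_ge0.
(* The spread parameter is [v ^+ 2] so that one factor [v] shrinks the size and the other bounds the
   lost mass. *)
by rewrite (_ : v ^+ 2 * j = v * (j * v)) ?decay_le //; ring.
Qed.

End Covering.

(** * Elementary asymptotics and the sequence of thresholds *)

Section Asymptotics.
Context {R : realType}.

Lemma powR_eventually_ge (a M : R) : 0 < a ->
  exists n0 : nat, forall n, (n0 <= n)%N -> M <= n%:R `^ a.
Proof.
move=> a0; pose B := Num.max M 1.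
have B0 : 0 <= B by rewrite le_max ler01 orbT.
have Ba0 := powR_ge0 B a^-1.
exists (Num.truncn (B `^ a^-1)).+1 => n hn.
have nB : B `^ a^-1 <= n%:R.
  by rewrite (le_trans (ltW (truncnS_gt _))) // ler_nat.
apply: (@le_trans _ _ B); first by rewrite le_max lexx.
have {1}-> : B = (B `^ a^-1) `^ a by rewrite -powRrM mulVf ?gt_eqF // powRr1.
by rewrite ge0_ler_powR ?nnegrE ?(ltW a0) ?ler0n.
Qed.

(** After taking logarithms, a linear term has to beat [ln n], which is at most twice the square
    root of [n]. *)
Lemma half_expn_eventually_le (c b : R) : 0 < c -> 0 < b ->
  exists n0 : nat, forall n, (n0 <= n)%N ->
    forall m : nat, c * n%:R < m%:R -> 2^-1 ^+ m <= n%:R `^ (- b) :> R.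
Proof.
move=> c0 b0; have l2 : 0 < ln 2 :> R by rewrite ln_gt0 // ltr1n.
have half0 : 0 < 2^-1 :> R by rewrite invr_gt0 ltr0n.
have [n0 hn0] := powR_eventually_ge (2 * b / (c * ln 2)) half0.
exists n0.+1 => n hn m hm; have {}hn0 := hn0 n (ltnW hn).
have n0' : 0 < n%:R :> R by rewrite ltr0n (leq_trans _ hn).
have e2 : 2^-1 = expR (- ln 2) :> R by rewrite expRN lnK ?posrE.
rewrite e2 -expRM_natr /powR (gt_eqF n0') ler_expR.
rewrite !mulNr lerN2.
pose s : R := n%:R `^ 2^-1.
have ss : n%:R = s * s.
  rewrite /s -powRD ?(gt_eqF n0') ?implybT // (_ : 2^-1 + 2^-1 = 1); last by field.
  by rewrite powRr1 ?(ltW n0').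
have s0 : 0 < s by rewrite powR_gt0.
have lns : ln n%:R = 2 * ln s :> R.
  by rewrite {1}ss lnM ?posrE //; ring.
rewrite lns (@le_trans _ _ (b * (2 * s))) ?ler_wpM2l ?(ltW b0) ?(ltW (ln_sublinear s0)) //.
apply: (@le_trans _ _ (ln 2 * (c * n%:R))); last by rewrite ler_wpM2l ?(ltW l2) // ltW.
rewrite ss.
move: hn0; rewrite -/s ler_pdivrMr ?mulr_gt0 // => h.
have := ler_wpM2r (ltW s0) h.
have E (a e f : R) : a * (e * f) * a = f * (e * (a * a)) by ring.
by rewrite E [2 * b]mulrC -mulrA.
Qed.

(* [l] is the first index at which the geometric sequence from [r1] drops to 1. *)
Lemma threshold_sequence (r0 r1 rho M : R) :
  1 < r1 -> r1 < r0 -> 1 < rho -> rho <= M -> r0 <= M * r1 ->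
  exists (l : nat) (r : nat -> R),
  [/\ (0 < l)%N, r 0%N = r0, r 1%N = r1,
      (forall i, (2 <= i <= l.-1)%N -> r i = r i.-1 / rho) & r l = 1] /\
  [/\ forall i, (1 <= i <= l)%N -> r i < r i.-1,
      forall i, (1 <= i <= l)%N -> 1 <= r i,
      forall i, (1 <= i <= l)%N -> r i.-1 <= M * r i,
      1 < r l.-1 & r l.-1 <= rho].
Proof.
move=> r11 r10 rho1 rhoM r0M.
have rho0 : 0 < rho by rewrite (lt_trans ltr01).
have ex : exists m, r1 / rho ^+ m <= 1.
  have [N hN] : exists N : nat, r1 < N%:R * (rho - 1).
    exists (Num.truncn (r1 / (rho - 1))).+1.
    by rewrite -ltr_pdivrMr ?subr_gt0 // truncnS_gt.
  exists N; rewrite ler_pdivrMr ?exprn_gt0 // mul1r (le_trans (ltW hN)) //.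
  (* Bernoulli's inequality. *)
  have : 1 + N%:R * (rho - 1) <= rho ^+ N.
    elim: (N) => [|k IH]; first by rewrite mul0r addr0 expr0.
    rewrite exprS -natr1 (le_trans _ (ler_wpM2l (ltW rho0) IH)) //.
    rewrite -subr_ge0 (_ : _ - _ = k%:R * (rho - 1) ^+ 2); last by ring.
    by rewrite mulr_ge0 ?ler0n ?sqr_ge0.
  by apply: le_trans; rewrite lerDr.
case: (ex_minnP ex) => m hm mmin.
have m0 : (0 < m)%N.
  by case: m hm {mmin} => // ; rewrite expr0 divr1 leNgt r11.
have gt1 i : (i < m)%N -> 1 < r1 / rho ^+ i.
  by move=> im; rewrite ltNge; apply/negP => /mmin; rewrite leqNgt im.
(* The geometric rule stops at index [m]; the value at [l = m.+1] is set to 1. Since [m] is least,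
   [r m] lies above 1 and at most at [rho]. *)
pose r i := if i == 0%N then r0 else if (i <= m)%N then r1 / rho ^+ i.-1 else 1.
have rS i : (i < m)%N -> r i.+1 = r1 / rho ^+ i by move=> im; rewrite /r /= im.
have rm : r m.+1 = 1 by rewrite /r /= ltnn.
have r1E : r 1%N = r1 by rewrite (rS _ m0) expr0 divr1.
have last : r m <= rho.
  rewrite -(prednK m0) rS ?prednK // ler_pdivrMr ?exprn_gt0 //.
  by move: hm; rewrite -exprS prednK // ler_pdivrMr ?exprn_gt0 // mul1r.
have last1 : 1 < r m by rewrite -(prednK m0) rS ?gt1 ?prednK.
exists m.+1, r; split; split=> //=.
- move=> [|[|i]] //= im; rewrite !rS //; last exact: ltnW.
  by rewrite exprSr invfM mulrA.
- move=> [|[|i]] //=; first by rewrite r1E.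
  rewrite ltnS leq_eqVlt => /orP[/eqP im|im]; first by rewrite im rm.
  rewrite !rS //; last exact: ltnW.
  rewrite ltr_pM2l ?(lt_trans ltr01) // ltf_pV2 ?posrE ?exprn_gt0 //.
  by rewrite exprS ltr_pMl ?exprn_gt0.
- move=> [|i] //=; rewrite ltnS leq_eqVlt => /orP[/eqP ->|im]; first by rewrite rm.
  by rewrite rS // ltW // gt1.
- move=> [|[|i]] //=; first by rewrite r1E.
  rewrite ltnS leq_eqVlt => /orP[/eqP im|im].
    by rewrite im rm mulr1 (le_trans last).
  rewrite !rS //; last exact: ltnW.
  have E (a b c e : R) : a * (b * (c * e)) = (a * c) * (b * e) by ring.
  rewrite exprS invfM E ler_peMl //; last by rewrite ler_pdivlMr ?mul1r.
  by rewrite mulr_ge0 ?invr_ge0 ?exprn_ge0 ?(ltW rho0) ?(ltW (lt_trans ltr01 r11)).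
Qed.

End Asymptotics.

(** * The induced distribution on copies *)

Section Copies.
Context {R : realType}.

(** Markov-type bound: for an index on the left, the single set [X = A i :&: S] already contributes
    [x ^+ t] or more. *)
Lemma sum_large_intersection_le (T I : finType) (nu : I -> R) (A : I -> {set T})
    (x : R) (S : {set T}) (t : nat) :
  (forall i, 0 <= nu i) -> 1 <= x -> (0 < t)%N ->
  \sum_(i | (t <= #|A i :&: S|)%N) nu i <=
  x ^- t * \sum_(X : {set T} | (X \subset S) && (X != set0))
             (\sum_(i | X \subset A i) nu i) * x ^+ #|X|.
Proof.
move=> nu0 x1 t0; have x0 : 0 < x by rewrite (lt_le_trans ltr01).
have -> : \sum_(X : {set T} | (X \subset S) && (X != set0))
    (\sum_(i | X \subset A i) nu i) * x ^+ #|X| =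
  \sum_i \sum_(X : {set T} | [&& X \subset S, X != set0 & X \subset A i]) nu i * x ^+ #|X|.
  under eq_bigr do rewrite mulr_suml.
  rewrite (exchange_big_dep predT) //=; apply: eq_bigr => i _.
  by apply: eq_bigl => X; rewrite andbA.
rewrite mulr_sumr big_mkcond; apply: ler_sum => i _.
have s0 : 0 <= \sum_(X : {set T} | [&& X \subset S, X != set0 & X \subset A i]) nu i * x ^+ #|X|.
  by apply: sumr_ge0 => X _; rewrite mulr_ge0 ?exprn_ge0 ?(ltW x0).
case: ifPn => [ti|_]; last by rewrite mulr_ge0 ?invr_ge0 ?exprn_ge0 ?(ltW x0).
rewrite mulrC ler_pdivlMr ?exprn_gt0 // (bigD1 (A i :&: S)) /=; last first.
  by rewrite subsetIr subsetIl -card_gt0 (leq_trans t0 ti).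
rewrite (le_trans (_ : _ <= nu i * x ^+ #|A i :&: S|)) //.
  by rewrite ler_wpM2l // ler_weXn2l.
by rewrite lerDl sumr_ge0 // => X _; rewrite mulr_ge0 ?exprn_ge0 ?(ltW x0).
Qed.

Context {V W : finType} (G : {set {set V}}) (H : {set {set W}}).
Context (mu : {ffun V -> W} -> R).

Lemma copiesP (A : {set {set W}}) : A \in copies G H ->
  exists2 psi : {ffun V -> W}, injective psi & A = edge_image psi G.
Proof.
rewrite inE => /existsP[U /andP[_ /existsP[psi /and3P[/injectiveP inj _ /eqP /= <-]]]].
by exists psi.
Qed.

Lemma edge_image_copies (psi : {ffun V -> W}) : injective psi ->
  edge_image psi G \subset H -> edge_image psi G \in copies G H.
Proof.
move=> inj GH; rewrite inE; apply/existsP; exists (psi @: [set: V]).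
rewrite /subhypergraph /= GH /=; apply/andP; split.
  apply/forallP => f; apply/implyP => /imsetP[e _ ->].
  by apply: imsetS; apply/subsetP => v; rewrite inE.
by apply/existsP; exists psi; rewrite !eqxx !andbT; apply/injectiveP.
Qed.

Definition copy_distr (B : {set {set W}}) : R := \sum_(psi | edge_image psi G == B) mu psi.

Lemma pr_copy_distr (E : {set {set {set W}}}) :
  pr copy_distr E = \sum_(psi | edge_image psi G \in E) mu psi.
Proof.
rewrite /pr (partition_big (fun psi => edge_image psi G) (mem E)) //=.
apply: eq_bigr => B BE; apply: eq_bigl => psi.
by case: eqP => [->|]; rewrite ?andbF // BE.
Qed.

Lemma embeddingsP (psi : {ffun V -> W}) : psi \in embeddings G H ->
  injective psi /\ edge_image psi G \subset H.
Proof.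
rewrite inE => /andP[/injectiveP inj /forallP h]; split=> //.
by apply/subsetP => f /imsetP[e eG ->]; have := h e; rewrite eG.
Qed.

Lemma copy_distrP : distr_on (embeddings G H) mu -> distr_on (copies G H) copy_distr.
Proof.
move=> [mu0 muD mu1]; split.
- by move=> B; exact: sumr_ge0.
- move=> B BH; apply: big1 => psi /eqP psiB; apply: muD; apply: contra BH.
  by move=> /embeddingsP[inj sub]; rewrite -psiB edge_image_copies.
- rewrite -mu1 [RHS](partition_big (fun psi => edge_image psi G) predT) //.
Qed.

End Copies.

(** * Both spread properties of the copies *)

Section SpreadCopies.
Context {R : realType} {V W : finType} (d alpha eps C' : R) (k Delta : nat).
Context (G : {set {set V}}) (mu : {ffun V -> W} -> R).
Context (k2 : (2 <= k)%N) (kG : k_uniform k G) (d0 : 0 < d) (alpha0 : 0 < alpha)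
  (C'0 : 0 < C') (degG : degenerate_with d alpha eps G)
  (maxG : (max_degree G <= Delta)%N) (V0 : (0 < #|V|)%N).

Let N : R := #|V|%:R.
Let K0 := spread_const k Delta C'.
Let u := N `^ (- (alpha / d)).

Context (tail : forall m : nat, eps * N < (k * m)%:R -> 2^-1 ^+ m <= u).

Lemma embeddings_spread_family :
  (forall psi, 0 <= mu psi) -> \sum_psi mu psi = 1 ->
  (forall psi, mu psi != 0 -> injective psi) -> vertex_spread (C' / N) mu ->
  spread_family (N `^ d^-1 / K0) u mu (fun psi => edge_image psi G).
Proof.
move=> mu0 mu1 muI spr psi0 S mupsi SG.
exact: (sum_contains_le k2 kG d0 C'0 degG maxG V0 mu0 mu1 muI spr (muI _ mupsi) SG tail).
Qed.

Lemma pr_copies_le (H : {set {set W}}) (A S : {set {set W}}) (t : nat) :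
  distr_on (embeddings G H) mu -> vertex_spread (C' / N) mu ->
  K0 <= N `^ d^-1 -> (0 < t)%N -> A \in copies G H -> S \subset A ->
  pr (copy_distr G mu) [set B in copies G H | (t <= #|B :&: S|)%N] <=
    (K0 / N `^ d^-1) ^+ t * (expR (u * #|S|%:R) - 1).
Proof.
move=> [mu0 muD mu1] spr K0P t0 /copiesP[psi0 inj0 ->] SG.
have muI psi : mu psi != 0 -> injective psi.
  move=> mupsi; have : psi \in embeddings G H.
    by apply: contraNT mupsi => /muD ->.
  by move/embeddingsP => [].
have K00 := spread_const_gt0 Delta k2 C'0.
have P0 : 0 < N `^ d^-1 by rewrite powR_gt0 // ltr0n.
have x1 : 1 <= N `^ d^-1 / K0 by rewrite ler_pdivlMr // mul1r.
rewrite pr_copy_distr.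
apply: (@le_trans _ _ (\sum_(psi | (t <= #|edge_image psi G :&: S|)%N) mu psi)).
  rewrite big_mkcond [leRHS]big_mkcond; apply: ler_sum => psi _; rewrite inE.
  by case: (edge_image psi G \in _) => //=; case: ifP.
apply: le_trans (sum_large_intersection_le _ _ mu0 x1 t0) _.
rewrite -exprVn invf_div ler_wpM2l ?exprn_ge0 ?divr_ge0 ?(ltW K00) ?(ltW P0) //.
have := sum_contains_le k2 kG d0 C'0 degG maxG V0 mu0 mu1 muI spr inj0 SG tail.
move/le_trans; apply; rewrite lerB // expRM_natr.
by rewrite lerXn2r ?nnegrE ?addr_ge0 ?powR_ge0 ?expR_ge0 ?expR_ge1Dx.
Qed.

Lemma copies_spread (H : {set {set W}}) :
  distr_on (embeddings G H) mu -> vertex_spread (C' / N) mu -> G != set0 ->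
  0 < eps < 1 -> 1 < N -> K0 * expR 1 <= N `^ d^-1 -> 1 < eps * N / k%:R ->
  d * k%:R / eps <= N `^ (alpha / d) ->
  exists (mu' : {set {set W}} -> R) (l : nat) (r : nat -> R),
    distr_on (copies G H) mu' /\
    (0 < l)%N /\
    r 0%N = d * N /\
    r 1%N = eps * N / k%:R /\
    (forall i : nat, (2 <= i <= l.-1)%N ->
       r i = r i.-1 / N `^ (9%:R * alpha / (10%:R * d))) /\
    r l = 1 /\
    spread (copies G H) (K0 * expR 1 / N `^ d^-1) l r mu' /\
    spread2 (copies G H) (K0 * expR 1 / N `^ d^-1)
      (N `^ (- (alpha / (10%:R * d)))) (r l.-1) 1 mu'.
Proof.
move=> muD spr G0 /andP[eps0 eps1] N1 K0P r11 large.
have N0 : 0 < N by rewrite (lt_trans ltr01).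
have k0 : 0 < k%:R :> R by rewrite ltr0n (ltn_trans _ k2).
have K00 : 0 < K0 := spread_const_gt0 Delta k2 C'0.
have P0 : 0 < N `^ d^-1 by rewrite powR_gt0.
have e1 : 1 <= expR 1 :> R by rewrite -[leLHS]expR0 ler_expR.
have K0P' : K0 <= N `^ d^-1 by rewrite (le_trans _ K0P) // ler_peMr // ltW.
have q01 : 0 <= K0 * expR 1 / N `^ d^-1 <= 1.
  apply/andP; split; last by rewrite ler_pdivrMr // mul1r.
  exact: divr_ge0 (mulr_ge0 (ltW K00) (expR_ge0 1)) (ltW P0).
(* A single edge gives [1 <= d * (k - 1)], and [eps < 1]. *)
have r10 : eps * N / k%:R < d * N.
  rewrite mulrAC ltr_pM2r // ltr_pdivrMr //.
  have /set0Pn[e eG] := G0.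
  have eG' : [set e] \subset G by rewrite sub1set.
  have := card_edges_le k2 kG degG eG'; rewrite -card_gt0 cards1 => /(_ isT).
  rewrite /cover big_set1 (uniform_card kG eG) => h.
  apply: (lt_le_trans eps1); apply: (le_trans h).
  by rewrite ler_pM2l // lerBlDr lerDl.
pose rho := N `^ (9%:R * alpha / (10%:R * d)).
pose M := N `^ (alpha / d).
have M0 : 0 < M by rewrite powR_gt0.
have rho1 : 1 < rho.
  have a0 : 0 < 9%:R * alpha / (10%:R * d) by rewrite divr_gt0 ?mulr_gt0 ?ltr0n.
  have := gt0_ltr_powR a0 (_ : 1 \in Num.nneg) (_ : N \in Num.nneg) N1.
  by rewrite powR1; apply; rewrite nnegrE // ltW.
have rhoM : rho <= M.
  rewrite ler_powR ?(ltW N1) // -subr_ge0.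
  rewrite (_ : _ - _ = alpha / (10%:R * d)); last by field; rewrite gt_eqF.
  by rewrite divr_ge0 ?mulr_ge0 ?(ltW alpha0) ?(ltW d0) ?ler0n.
have r0M : d * N <= M * (eps * N / k%:R).
  have : d * k%:R <= M * eps by rewrite -ler_pdivrMr.
  move=> h; rewrite mulrA ler_pdivlMr // mulrAC mulrA ler_wpM2r ?(ltW N0) //.
have uM : u * M = 1 by rewrite /u /M powRN mulVf // gt_eqF.
have [l [r [[l0 rE0 rE1 rE rl] [rlt r_ge1 rM rl1 rl_rho]]]] :=
  threshold_sequence r11 r10 rho1 rhoM r0M.
have qt t : (K0 * expR 1 / N `^ d^-1) ^+ t = (K0 / N `^ d^-1) ^+ t * expR 1 ^+ t.
  by rewrite mulrAC exprMn.
exists (copy_distr G mu), l, r; split; first exact: copy_distrP.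
do 5!split=> //; split.
  split=> //.
    move=> A /copiesP[psi inj ->]; rewrite card_edge_image // rE0.
    exact: (edges_le_linear k2 kG degG).
  move=> i t A S il /andP[rt _] AH SA /andP[_ Sr].
  have t0 : (0 < t)%N by rewrite -(ltr0n R) (lt_le_trans ltr01) // (le_trans (r_ge1 i il)).
  apply: (le_trans (pr_copies_le muD spr K0P' t0 AH SA)).
  rewrite qt ler_wpM2l ?exprn_ge0 ?divr_ge0 ?(ltW K00) ?(ltW P0) //.
  (* Here [#|S| <= r i.-1 <= M * r i <= M * t] and [u * M = 1], so the extra [expR 1 ^+ t] in the
     spread constant absorbs the exponential. *)
  apply: (@le_trans _ _ (expR (u * #|S|%:R))); first by rewrite lerBlDr lerDl.
  rewrite -expRM_natl mulr1 ler_expR.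
  have -> : t%:R = u * (M * t%:R) by rewrite mulrA uM mul1r.
  rewrite ler_wpM2l ?powR_ge0 //.
  by apply: (le_trans Sr); apply: (le_trans (rM i il)); rewrite ler_wpM2l ?(ltW M0).
pose gam := N `^ (- (alpha / (10%:R * d))).
have g1 : gam <= 1.
  rewrite -[leRHS](powRr0 N) ler_powR ?(ltW N1) // oppr_le0.
  by rewrite divr_ge0 ?mulr_ge0 ?(ltW alpha0) ?(ltW d0) ?ler0n.
split=> //; first by rewrite powR_ge0.
move=> t A S /andP[t1 _] AH SA /andP[_ Sr].
have t0 : (0 < t)%N by rewrite -(ltr0n R) (lt_le_trans ltr01).
apply: (le_trans (pr_copies_le muD spr K0P' t0 AH SA)).
rewrite qt mulrCA ler_wpM2l ?exprn_ge0 ?divr_ge0 ?(ltW K00) ?(ltW P0) //.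
(* Below [r l.-1 <= rho] the exponents combine to [- alpha / d + 9 alpha / (10 d)], which is that of
   [gam]. *)
have us : u * #|S|%:R <= gam.
  apply: (@le_trans _ _ (u * rho)).
    by rewrite ler_wpM2l ?powR_ge0 // (le_trans Sr).
  rewrite /u /rho /gam -powRD ?(gt_eqF N0) ?implybT //.
  by rewrite (_ : _ + _ = - (alpha / (10%:R * d))) //; field; rewrite gt_eqF.
apply: le_trans (expR_sub1_le _) _.
rewrite ler_pM ?mulr_ge0 ?powR_ge0 ?expR_ge0 //.
rewrite -expRM_natl mulr1 ler_expR (le_trans us) // (le_trans g1) //.
Qed.

End SpreadCopies.

(** * Containment in the random hypergraph *)

Section Threshold.
Context {R : realType}.

Lemma random_hypergraphE (k n : nat) (p : R) (E : {set {set 'I_n}}) :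
  random_hypergraph k p E =
  if E \subset [set e : {set 'I_n} | #|e| == k]
  then subset_weight [set e : {set 'I_n} | #|e| == k] p E else 0.
Proof.
rewrite /random_hypergraph; set D := [set e | _].
have -> : k_uniform k E = (E \subset D).
  apply/forallP/subsetP => [h e eE|h e]; last by apply/implyP => /h; rewrite inE.
  by have := h e; rewrite eE inE.
case: ifP => // /setIidPr ED; rewrite /subset_weight.
rewrite (bigID (mem E)) /=; congr (_ * _).
  rewrite (eq_bigr (fun=> p)) => [|e /andP[_ ->] //].
  rewrite prodr_const; congr (_ ^+ _); rewrite -{2}ED.
  by apply: eq_card => e; rewrite !inE unfold_in /=.
rewrite (eq_bigr (fun=> 1 - p)) => [|e /andP[_ /negbTE ->] //].
rewrite prodr_const; congr (_ ^+ _).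
by apply: eq_card => e; rewrite !inE unfold_in /= andbC.
Qed.

(** The random hypergraph lives on ordinals, so embeddings into [W] are transported along its
    enumeration. *)
Lemma vertex_spread_relabel (V W : finType) (q : R) (mu : {ffun V -> W} -> R) :
  vertex_spread q mu ->
  vertex_spread q (fun phi : {ffun V -> 'I_#|W|} => mu [ffun v => enum_val (phi v)]).
Proof.
move=> spr s x y sV xI yI.
apply: le_trans (spr s x (fun i => enum_val (y i)) sV xI _); last first.
  by move=> i j /enum_val_inj /yI.
rewrite le_eqVlt; apply/orP; left; apply/eqP; rewrite /pr.
rewrite [RHS](reindex (fun phi : {ffun V -> 'I_#|W|} => [ffun v => enum_val (phi v)])) /=.
  apply: eq_bigl => phi; rewrite !inE; apply: eq_forallb => i.
  by rewrite ffunE (inj_eq enum_val_inj).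
exists (fun psi : {ffun V -> W} => [ffun v => enum_rank (psi v)]) => phi _;
  by apply/ffunP => v; rewrite !ffunE ?enum_valK ?enum_rankK.
Qed.

Lemma sum_relabel (V W : finType) (mu : {ffun V -> W} -> R) :
  \sum_(phi : {ffun V -> 'I_#|W|}) mu [ffun v => enum_val (phi v)] = \sum_psi mu psi.
Proof.
rewrite [RHS](reindex (fun phi : {ffun V -> 'I_#|W|} => [ffun v => enum_val (phi v)])) //=.
exists (fun psi : {ffun V -> W} => [ffun v => enum_rank (psi v)]) => phi _;
  by apply/ffunP => v; rewrite !ffunE ?enum_valK ?enum_rankK.
Qed.

(** An exposed hypergraph without a copy of [G] contains no image of an embedding of positive mass,
    so it is missed. *)
Lemma pr_contains_copy_ge (k n : nat) (p : R) (V : finType) (G : {set {set V}})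
    (nu : {ffun V -> 'I_n} -> R) :
  0 <= p <= 1 -> (forall psi, nu psi != 0 -> injective psi) ->
  1 - subset_mean [set e : {set 'I_n} | #|e| == k] p
        (missed nu (fun psi => edge_image psi G)) <= pr_contains_copy k n p G.
Proof.
move=> p01 nuI; set D := [set e | _].
rewrite lerBlDr -[leLHS](subset_mean_cst D p) /pr_contains_copy /pr.
rewrite /subset_mean [X in _ <= X + _]big_mkcond [leLHS]big_mkcond.
rewrite [X in _ <= _ + X]big_mkcond -big_split /=; apply: ler_sum => E _.
rewrite random_hypergraphE -/D inE; case: ifPn => ED; last by case: ifP => _; rewrite addr0.
rewrite mulr1; case: ifPn => [_|/negbNE/eqP noC].
  by rewrite lerDl mulr_ge0 ?subset_weight_ge0.
rewrite add0r /missed; case: forallP => [_|]; first by rewrite mulr1.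
case=> psi; apply/implyP => nupsi; apply/negP => sub.
by have := edge_image_copies (nuI _ nupsi) sub; rewrite noC inE.
Qed.

Lemma threshold_le (V W : finType) (d alpha eps C' p : R) (k Delta m : nat)
    (G : {set {set V}}) (mu : {ffun V -> W} -> R) :
  (2 <= k)%N -> k_uniform k G -> 0 < d -> 0 < alpha -> 0 < C' ->
  degenerate_with d alpha eps G -> (max_degree G <= Delta)%N ->
  let N : R := #|V|%:R in let K0 := spread_const k Delta C' in
  let v := N `^ (- (alpha / (2 * d))) in
  (0 < #|V|)%N ->
  (forall m : nat, eps * N < (k * m)%:R -> 2^-1 ^+ m <= N `^ (- (alpha / d))) ->
  (forall psi, 0 <= mu psi) -> \sum_psi mu psi = 1 ->
  (forall psi, mu psi != 0 -> injective psi) -> vertex_spread (C' / N) mu ->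
  expR 2 * K0 < N `^ d^-1 -> d * N * v ^+ m < 1 -> 0 <= p <= 1 ->
  m%:R * expR 2 * K0 * N `^ (- d^-1) <= p ->
  1 - m%:R * v <= pr_contains_copy k #|W| p G.
Proof.
move=> k2 kG d0 alpha0 C'0 degG maxG N K0 v V0 tail mu0 mu1 muI spr KP jv p01 mp.
have N1 : 1 <= N by rewrite /N ler1n.
have N0 : 0 < N by rewrite (lt_le_trans ltr01).
have K00 : 0 < K0 := spread_const_gt0 Delta k2 C'0.
have P0 : 0 < N `^ d^-1 by rewrite powR_gt0.
pose nu (phi : {ffun V -> 'I_#|W|}) := mu [ffun v => enum_val (phi v)].
have nuI phi : nu phi != 0 -> injective phi.
  by move=> /muI inj a b ab; apply: inj; rewrite !ffunE ab.
have nu1 : \sum_phi nu phi = 1 by rewrite sum_relabel.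
apply: le_trans (pr_contains_copy_ge k G p01 nuI); rewrite lerB //.
suff : (\sum_phi nu phi) * subset_mean [set e : {set 'I_#|W|} | #|e| == k] p
    (missed nu (fun phi => edge_image phi G)) <= m%:R * v by rewrite nu1 mul1r.
have v0 : 0 <= v by exact: powR_ge0.
have v2 : v ^+ 2 = N `^ (- (alpha / d)).
  rewrite -powR_mulrn ?powR_ge0 // -powRrM; congr (_ `^ _).
  by field; rewrite gt_eqF.
(* The density of a round is chosen so that [p1 * x = expR 2]; sizes start from the bound [d * N] on
   the number of edges. *)
have := @mean_missed_le R _ _ [set e : {set 'I_#|W|} | #|e| == k]
  (expR 2 * K0 / N `^ d^-1) (N `^ d^-1 / K0) v m p (d * N) nu (fun phi => edge_image phi G).
apply=> //.
- by rewrite divr_gt0 ?(mulr_gt0 (expR_gt0 2) K00) //= ltr_pdivrMr // mul1r.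
- exact: divr_ge0 (ltW P0) (ltW K00).
- rewrite (_ : _ * _ = expR 2) //; move: (expR 2) => e.
  rewrite mulrA divfK ?gt_eqF //; exact: mulfK (lt0r_neq0 K00) e.
- rewrite v0 /v -[leRHS](powRr0 N) ler_powR // oppr_le0.
  by rewrite divr_ge0 ?mulr_ge0 ?(ltW alpha0) ?(ltW d0).
- by apply: le_trans mp; rewrite powRN !mulrA.
- by rewrite mulr_ge0 ?(ltW d0) ?(ltW N0).
- by move=> phi; exact: mu0.
- move=> phi nuphi; apply/subsetP => _ /imsetP[e eG ->]; rewrite inE.
  by rewrite card_imset ?(uniform_card kG eG) //; exact: nuI.
- move=> phi nuphi; rewrite card_edge_image; last exact: nuI.
  have [->|G0] := eqVneq G set0; first by rewrite cards0 mulr_ge0 ?(ltW d0) ?(ltW N0).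
  exact: (edges_le_linear k2 kG degG).
- rewrite v2; apply: (embeddings_spread_family k2 kG d0 C'0 degG maxG V0 tail) => //.
    by move=> phi; exact: mu0.
  exact: vertex_spread_relabel.
Qed.

End Threshold.

(** * Choice of the constants and assembly of both conclusions *)

Local Open Scope classical_set_scope.

(** [C] and [Cstar] are fixed before [eps], while [delta] and [n0] may depend on it but are uniform
    in [G] and [H]. A nonempty [G] forces [d] to be large enough for [r 1 < r 0]. *)
Theorem theorem4p3 (R : realType) (k Delta : nat) (d alpha C' : R)
    (hk : (2 <= k)%N) (hd : 0 < d) (halpha : 0 < alpha) (hC' : 0 < C') :
  exists C Cstar : R, 0 < C /\ 0 < Cstar /\
  forall eps : R,
  exists delta : nat -> R, delta n @[n --> \oo] --> (0 : R) /\
  exists n0 : nat, forall n : nat, (n0 <= n)%N ->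
  forall (V W : finType) (G : hypergraph V) (H : hypergraph W),
    #|V| = n -> #|W| = n -> k_uniform k G -> k_uniform k H ->
    degenerate_with d alpha eps G ->
    (max_degree G <= Delta)%N ->
    (exists mu : {ffun V -> W} -> R,
       distr_on (embeddings G H) mu /\ vertex_spread (C' / n%:R) mu) ->
    (G != finset.set0 ->
     exists (mu' : {set {set W}} -> R) (l : nat) (r : nat -> R),
       distr_on (copies G H) mu' /\
       (0 < l)%N /\
       r 0%N = d * n%:R /\
       r 1%N = eps * n%:R / k%:R /\
       (forall i : nat, (2 <= i <= l.-1)%N ->
          r i = r i.-1 / n%:R `^ (9%:R * alpha / (10%:R * d))) /\
       r l = 1 /\
       spread (copies G H) (C / n%:R `^ d^-1) l r mu' /\
       spread2 (copies G H) (C / n%:R `^ d^-1)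
         (n%:R `^ (- (alpha / (10%:R * d)))) (r l.-1) 1 mu') /\
    (forall p : R, 0 <= p <= 1 -> Cstar * n%:R `^ (- d^-1) <= p ->
       1 - delta n <= pr_contains_copy k n p G).
Proof.
pose K0 := spread_const k Delta C'.
have K00 : 0 < K0 := spread_const_gt0 Delta hk hC'.
have k0 : 0 < k%:R :> R by rewrite ltr0n (ltn_trans _ hk).
(* This number of rounds makes [v ^+ m] at most [n ^ (-2)], so that [d * n * v ^+ m < 1] once
   [n > d]. *)
pose m := (Num.truncn (4 * d / alpha)).+1.
have m_large : 4 * d / alpha <= m%:R by rewrite ltW // truncnS_gt.
have b0 : 0 < alpha / (2 * d) by rewrite divr_gt0 ?mulr_gt0.
have ad0 : 0 < alpha / d by rewrite divr_gt0.
have d'0 : 0 < d^-1 by rewrite invr_gt0.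
exists (K0 * expR 1), (m%:R * expR 2 * K0).
split; first exact: mulr_gt0 K00 (expR_gt0 1).
split; first by rewrite mulr_gt0 // mulr_gt0 ?expR_gt0 ?ltr0n.
move=> eps; exists (fun n => m%:R * n%:R `^ (- (alpha / (2 * d)))); split.
  apply/cvgr0Pnorm_le => e e0.
  have [n0 hn0] := powR_eventually_ge (m%:R / e) b0.
  exists n0 => // n /= /hn0; rewrite ler_pdivrMr // => h.
  rewrite ger0_norm ?mulr_ge0 ?powR_ge0 // powRN ler_pdivrMr.
    by rewrite mulrC.
  rewrite lt_neqAle powR_ge0 andbT eq_sym; apply/eqP => n0'.
  by move: h; rewrite n0' mul0r lern0.
have [eps01|neps] := boolP (0 < eps < 1); last first.
  by exists 0%N => n _ V W G H _ _ _ _ [_ h _]; rewrite h in neps.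
have /andP[eps0 eps1] := eps01.
have epsk : 0 < eps / k%:R by rewrite divr_gt0.
(* In order, the thresholds on [n] secure: the bound for large components, spread constant at most
   1, round density below 1, [r 1 > 1], [r 0 <= M * r 1], and [d < n]. *)
have [n1 h1] := half_expn_eventually_le epsk ad0.
have [n2 h2] := powR_eventually_ge (K0 * expR 1) d'0.
have [n3 h3] := powR_eventually_ge (expR 2 * K0 + 1) d'0.
have [n4 h4] := powR_eventually_ge ((eps / k%:R)^-1 + 1) (@ltr01 R).
have [n5 h5] := powR_eventually_ge (d * k%:R / eps) ad0.
have [n6 h6] := powR_eventually_ge (d + 1) (@ltr01 R).
exists (maxn 2 (maxn n1 (maxn n2 (maxn n3 (maxn n4 (maxn n5 n6)))))) => n.
rewrite !geq_max => /and5P[n_ge2 /h1 tail /h2 c2 /h3 c3 /and3P[/h4 c4 /h5 c5 /h6 c6]].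
move=> V W G H Vn Wn kG kH degG maxG [mu [muD spr]].
have N1 : 1 < n%:R :> R by rewrite ltr1n.
have N0 : 0 < n%:R :> R by rewrite (lt_trans ltr01).
have V0 : (0 < #|V|)%N by rewrite Vn (leq_trans _ n_ge2).
rewrite powRr1 ?(ltW N0) // in c4; rewrite powRr1 ?(ltW N0) // in c6.
have tail' (i : nat) : eps * n%:R < (k * i)%:R ->
    2^-1 ^+ i <= n%:R `^ (- (alpha / d)) :> R.
  by move=> h; apply: tail; rewrite mulrAC ltr_pdivrMr // -natrM mulnC.
split=> [G0|p p01 hp].
  have := @copies_spread R V W d alpha eps C' k Delta G mu hk kG hd halpha hC' degG
    maxG V0; rewrite Vn; apply=> //.
  rewrite mulrAC -ltr_pdivrMl // mulr1 (lt_le_trans _ c4) //.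
  by rewrite ltrDl.
have [mu0 muDD mu1] := muD.
have muI psi : mu psi != 0 -> injective psi.
  move=> mupsi; have : psi \in embeddings G H by apply: contraNT mupsi => /muDD ->.
  by move/embeddingsP => [].
have := @threshold_le R V W d alpha eps C' p k Delta m G mu hk kG hd halpha hC' degG
    maxG; rewrite /= Vn Wn; apply=> //.
- by rewrite -Vn.
- by rewrite (lt_le_trans _ c3) // ltrDl.
- rewrite -powR_mulrn ?powR_ge0 // -powRrM.
  apply: (@le_lt_trans _ _ (d * n%:R * n%:R `^ (- 2%:R))).
    rewrite ler_wpM2l ?mulr_ge0 ?(ltW hd) ?(ltW N0) // ler_powR ?(ltW N1) //.
    rewrite mulNr lerN2 -ler_pdivrMl //.
    by rewrite (_ : _ * 2 = 4 * d / alpha) //; field; rewrite !gt_eqF.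
  rewrite powR_invn ?(ltW N0) // ltr_pdivrMr ?exprn_gt0 // mul1r expr2 ltr_pM2r //.
  by rewrite (lt_le_trans _ c6) // ltrDl.
Qed.
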